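(* Let $A=\sigma(R)\langle x_1,\dots,x_n\rangle$ be a bijective skew PBW extension of a right Gröbner soluble ring $R$, let $m\ge1$, and fix a monomial order on $\mathrm{Mon}(A^m)$. Let $F=\{\mathbf f_1,\dots,\mathbf f_s\}$ be a set of non-zero vectors of $A^m$. Then the right Buchberger algorithm (described in the context), applied to $F$, produces a Gröbner basis for the right submodule $\langle F\rangle$ of $A^m$ generated by $F$.
   Context: **Skew PBW extensions.** Rings are associative with $1$. Let $R\subseteq A$ be rings. $A$ is a skew PBW extension of $R$, written $A=\sigma(R)\langle x_1,\dots,x_n\rangle$, if there are $x_1,\dots,x_n\in A$ such that: $A$ is a free left $R$-module with basis $\mathrm{Mon}(A)=\{x^\alpha:=x_1^{\alpha_1}\cdots x_n^{\alpha_n}\mid\alpha\in\mathbb N^n\}$; for every $i$ and $0\ne r\in R$ there is $c_{i,r}\in R\setminus\{0\}$ with $x_ir-c_{i,r}x_i\in R$; for all $i,j$ there is $c_{i,j}\in R\setminus\{0\}$ with $x_jx_i-c_{i,j}x_ix_j\in R+Rx_1+\cdots+Rx_n$. Then there are injective ring endomorphisms $\sigma_i$ of $R$ and $\sigma_i$-derivations $\delta_i$ with $x_ir=\sigma_i(r)x_i+\delta_i(r)$ for all $r\in R$. $A$ is bijective if every $\sigma_i$ is bijective and every $c_{i,j}$ is invertible. Put $|\alpha|=\alpha_1+\cdots+\alpha_n$, $\deg(x^\alpha)=|\alpha|$, $\sigma^\alpha=\sigma_1^{\alpha_1}\cdots\sigma_n^{\alpha_n}$ and $\sigma^{-\alpha}=(\sigma^\alpha)^{-1}$;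 the degree of a non-zero $f\in A$ is the largest degree of a monomial occurring in it. For $\alpha,\beta\in\mathbb N^n$, $c_{\alpha,\beta}\in R$ is the unique element with $x^\alpha x^\beta=c_{\alpha,\beta}x^{\alpha+\beta}+p_{\alpha,\beta}$, where $p_{\alpha,\beta}=0$ or $\deg p_{\alpha,\beta}<|\alpha+\beta|$ (it is invertible when $A$ is bijective). For $\theta_1,\theta_2\in\mathbb N^n$ let $\psi_{\theta_1,\theta_2}:R\to R$ be the automorphism $\psi_{\theta_1,\theta_2}(r)=\sigma^{\theta_1+\theta_2}(\sigma^{-\theta_2}(r))$. **Right Gröbner soluble (RGS) ring.** $R$ is RGS if it is right Noetherian; there is an algorithm which, given $a,r_1,\dots,r_m\in R$, decides whether $a\in r_1R+\cdots+r_mR$ and, if so, finds $b_i\in R$ with $a=\sum r_ib_i$; and there is an algorithm which, given $r_1,\dots,r_m\in R$, finds a finite generating set of the right $R$-module $\mathrm{Syz}^r_R[r_1\cdots r_m]=\{(b_1,\dots,b_m)\in R^m\mid\sum r_ib_i=0\}$. **Monomial orders.** $A^m$ is the free right $A$-module of vectors of length $m$ with canonical basis $\mathbf e_1,\dots,\mathbf e_m$; $\mathrm{Mon}(A^m)$ is the set of vectors $\mathbf X=x^\alpha\mathbf e_i$, with $\mathrm{ind}(\mathbf X)=i$, $\exp(\mathbf X)=\alpha$, $\deg(\mathbf X)=|\alpha|$. A monomial order on $\mathrm{Mon}(A^m)$ is a total order $\succeq$ such that (i) $x^{\beta+\alpha}\mathbf e_i\succeq x^\alpha\mathbf e_i$;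 (ii) $x^\beta\mathbf e_j\succeq x^\alpha\mathbf e_i$ implies $x^{\gamma+\beta}\mathbf e_j\succeq x^{\gamma+\alpha}\mathbf e_i$ for all $\gamma$; (iii) $\deg\mathbf X>\deg\mathbf Y$ implies $\mathbf X\succ\mathbf Y$. Each $\mathbf f\ne\mathbf 0$ in $A^m$ is uniquely $\mathbf f=c_1\mathbf X_1+\cdots+c_k\mathbf X_k$ with $c_i\in R\setminus\{0\}$ and $\mathbf X_1\succ\cdots\succ\mathbf X_k$ monomials; $\mathrm{lm}(\mathbf f)=\mathbf X_1$, $\mathrm{lc}(\mathbf f)=c_1$. By convention $\mathrm{lm}(\mathbf 0)=\mathbf 0$, $\mathrm{lc}(\mathbf 0)=0$, and $\mathbf X\succ\mathbf 0$ for every monomial $\mathbf X$. The least common multiple of monomials of $A^m$ is $\mathbf 0$ if their indices are not all equal, and is $x^\mu\mathbf e_i$ if they all have index $i$, where $\mu$ is the componentwise maximum of their exponents. **Reduction.** For a finite set $F$ of non-zero vectors, $\mathbf f$ reduces to $\mathbf h$ by $F$ in one step, $\mathbf f\xrightarrow{F}\mathbf h$, if there are $\mathbf f_1,\dots,\mathbf f_t\in F$ and $r_1,\dots,r_t\in R$ such that (i) $\mathrm{lm}(\mathbf f_i)\mid\mathrm{lm}(\mathbf f)$, i.e. the indices agree and there is $\alpha_i\in\mathbb N^n$ with $\beta_i+\alpha_i=\exp(\mathrm{lm}(\mathbf f))$, $\beta_i:=\exp(\mathrm{lm}(\mathbf f_i))$; (ii) $\mathrm{lc}(\mathbf f)=\sum_{i=1}^t\mathrm{lc}(\mathbf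 f_i)\sigma^{\beta_i}(r_i)c_{\beta_i,\alpha_i}$; (iii) $\mathbf h=\mathbf f-\sum_{i=1}^t\mathbf f_ir_ix^{\alpha_i}$. By convention $\mathbf 0\xrightarrow{F}\mathbf 0$. $\mathbf f\xrightarrow{F}_+\mathbf h$ means that $\mathbf h$ is obtained from $\mathbf f$ by a finite chain of one-step reductions by $F$ (possibly of length zero, i.e. $\mathbf h=\mathbf f$). $\mathbf f$ is reduced with respect to $F$ if $\mathbf f=\mathbf 0$ or $\mathbf f$ admits no one-step reduction by $F$; otherwise it is reducible. **Gröbner basis.** For a right submodule $M\ne0$ of $A^m$, a non-empty finite subset $G$ of non-zero vectors of $M$ is a Gröbner basis for $M$ if each $\mathbf 0\ne\mathbf f\in M$ is reducible with respect to $G$. **$\mathbf X_S$ and $B_S$.** For a non-empty $S=\{\mathbf g_{i_1},\dots,\mathbf g_{i_k}\}$ of non-zero vectors of $A^m$, $\mathbf X_S$ is the least common multiple of the $\mathrm{lm}(\mathbf g_{i_j})$. When $\mathbf X_S\ne\mathbf 0$, put $\beta_{i_j}=\exp(\mathrm{lm}(\mathbf g_{i_j}))$ and let $\gamma_j\in\mathbb N^n$ be such that $\gamma_j+\beta_{i_j}=\exp(\mathbf X_S)$; $B_S$ denotes a finite set of generators in $R^k$ of the right $R$-module $\mathrm{Syz}^r_R[\mathrm{lc}(\mathbf g_{i_1})c_{\beta_{i_1},\gamma_1}\ \cdots\ \mathrm{lc}(\mathbf g_{i_k})c_{\beta_{i_k},\gamma_k}]$. **Right Buchberger algorithm.** Input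 $F=\{\mathbf f_1,\dots,\mathbf f_s\}$, $\mathbf f_i\ne\mathbf 0$. ($P(X)$ denotes the set of subsets of $X$.) Initialize $G\leftarrow\emptyset$, $G'\leftarrow F$. While $G'\ne G$: set $D\leftarrow P(G')-P(G)$, then $G\leftarrow G'$; for each $S=\{\mathbf g_{i_1},\dots,\mathbf g_{i_k}\}\in D$ with $\mathbf X_S\ne\mathbf 0$, compute $B_S$, and for each $(b_1,\dots,b_k)\in B_S$ reduce $\sum_{j=1}^k\mathbf g_{i_j}\psi^{-1}_{\beta_{i_j},\gamma_j}(b_j)x^{\gamma_j}\xrightarrow{G'}_+\mathbf r$ with $\mathbf r$ reduced with respect to the current $G'$; if $\mathbf r\ne\mathbf 0$ set $G'\leftarrow G'\cup\{\mathbf r\}$. When the loop ends, output $G$. *)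

(* Defs.v *)
From Stdlib Require Import Relation_Operators ClassicalEpsilon.
From HB Require Import structures.
From mathcomp Require Import all_boot all_order all_algebra.
From mathcomp Require Import finmap.
From mathcomp Require Import mpoly.

Set Implicit Arguments.
Unset Strict Implicit.
Unset Printing Implicit Defensive.

Import GRing.Theory.
Local Open Scope ring_scope.

(* [the t0 P] is the element satisfying [P] (some arbitrary element if there
   is none); below it is only used for elements that are unique. *)
Definition the {T : Type} (t0 : T) (P : T -> Prop) : T :=
  epsilon (inhabits t0) P.

Definition inv_fun (T : pzRingType) (f : T -> T) (y : T) : T :=
  the 0 (fun z => f z = y).

Definition invertible (T : pzRingType) (c : T) : Prop :=
  exists d : T, c * d = 1 /\ d * c = 1.

(* The right action of [a] on [v : 'cV_k] is [v *m a%:M]: every entry of [v]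
   is multiplied by [a] on the right. *)
Section RightModules.
Variable T : pzRingType.

Definition rspan (k : nat) (s : seq 'cV[T]_k) (v : 'cV[T]_k) : Prop :=
  exists c : 'I_(size s) -> T,
    v = \sum_(j < size s) s`_j *m (c j)%:M.

Definition rsyz (k : nat) (r : 'rV[T]_k) (b : 'cV[T]_k) : Prop := r *m b = 0.

Definition rsyz_generators (k : nat) (r : 'rV[T]_k) (B : seq 'cV[T]_k) : Prop :=
  forall b : 'cV[T]_k, rsyz r b <-> rspan B b.

Definition right_ideal (I : T -> Prop) : Prop :=
  [/\ I 0, forall a b, I a -> I b -> I (a + b) & forall a r, I a -> I (a * r)].

Definition right_noetherian : Prop :=
  forall I : nat -> T -> Prop,
    (forall k, right_ideal (I k)) ->
    (forall k a, I k a -> I k.+1 a) ->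
    exists N, forall k a, (N <= k)%N -> I k a -> I N a.

(* The two algorithms are functions carried by the structure. *)
Record RGS : Type := {
  RGS_noetherian : right_noetherian;
  RGS_member : forall k : nat, T -> 'rV[T]_k -> option 'cV[T]_k;
  RGS_memberP : forall (k : nat) (a : T) (r : 'rV[T]_k),
    if RGS_member a r is Some b then a%:M = r *m b
    else ~ exists b : 'cV[T]_k, a%:M = r *m b;
  RGS_syz : forall k : nat, 'rV[T]_k -> seq 'cV[T]_k;
  RGS_syzP : forall (k : nat) (r : 'rV[T]_k), rsyz_generators r (RGS_syz r)
}.

End RightModules.

(* The inclusion of R in A is the injective morphism [iota]; N^n is the type
   ['X_{1..n}] of multi-indices. *)
Section SkewPBW.
Variables (R A : pzRingType) (iota : {rmorphism R -> A}).
Variables (n : nat) (x : 'I_n -> A).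

Definition xmon (a : 'X_{1..n}) : A := \prod_(i < n) x i ^+ a i.

Definition lincomb (c : {fsfun 'X_{1..n} -> R with 0}) : A :=
  \sum_(a <- finsupp c) iota (c a) * xmon a.

Definition mon_basis : Prop :=
  forall f : A, exists! c : {fsfun 'X_{1..n} -> R with 0}, f = lincomb c.

(* [c] can be taken as the element c_{i,j} *)
Definition commutation (i j : 'I_n) (c : R) : Prop :=
  c != 0 /\
  exists (d0 : R) (d : 'I_n -> R),
    x j * x i - iota c * x i * x j = iota d0 + \sum_(k < n) iota (d k) * x k.

Definition skew_PBW : Prop :=
  [/\ injective iota,
      mon_basis,
      forall (i : 'I_n) (r : R), r != 0 ->
        exists c d : R, c != 0 /\ x i * iota r - iota c * x i = iota d
    & forall i j : 'I_n, exists c : R, commutation i j c].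

Definition sigma (i : 'I_n) (r : R) : R :=
  the 0 (fun s => exists d : R, x i * iota r = iota s * x i + iota d).

(* c_{i,j} is determined by freeness for i <= j. For i > j any choice of it is
   a left inverse of c_{j,i}, so asking for an invertible choice for each pair
   is the same as asking that every choice be invertible. *)
Definition bijective_PBW : Prop :=
  (forall i : 'I_n, bijective (sigma i)) /\
  (forall i j : 'I_n, exists c : R, commutation i j c /\ invertible c).

(* sigma_1^{a_1} o ... o sigma_n^{a_n}, the factor of index n acting first *)
Definition sigma_pow (a : 'X_{1..n}) (r : R) : R :=
  foldr (fun i s => iter (a i) (sigma i) s) r (enum 'I_n).

Definition psi (t1 t2 : 'X_{1..n}) (r : R) : R :=
  sigma_pow (t1 + t2)%MM (inv_fun (sigma_pow t2) r).

Definition coords (f : A) : {fsfun 'X_{1..n} -> R with 0} :=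
  the [fsfun] (fun c => f = lincomb c).

Definition deg (f : A) : nat := \max_(a <- finsupp (coords f)) mdeg a.

Definition cmon (a b : 'X_{1..n}) : R :=
  the 0 (fun c => exists p : A,
    xmon a * xmon b = iota c * xmon (a + b)%MM + p /\
    (p = 0 \/ (deg p < mdeg (a + b)%MM)%N)).

Section Vectors.
Variable m : nat.

(* x^a e_i is the pair (a, i) *)
Definition vmon : Type := ('X_{1..n} * 'I_m)%type.

(* [ge X Y] is X >= Y *)
Definition monomial_order (ge : rel vmon) : Prop :=
  [/\ [/\ total ge, antisymmetric ge & transitive ge],
      forall (a b : 'X_{1..n}) (i : 'I_m), ge ((b + a)%MM, i) (a, i),
      forall (a b c : 'X_{1..n}) (i j : 'I_m),
        ge (b, j) (a, i) -> ge ((c + b)%MM, j) ((c + a)%MM, i)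
    & forall X Y : vmon, (mdeg Y.1 < mdeg X.1)%N -> ge X Y && (X != Y)].

Variable ge : rel vmon.

Definition vsupp (f : 'cV[A]_m) : seq vmon :=
  [seq (a, i) | i <- enum 'I_m, a <- (finsupp (coords (f i 0)) : seq _)].

(* [None] plays the role of the vector 0, as in lm(0) = 0 *)
Definition lm (f : 'cV[A]_m) : option vmon := ohead (sort ge (vsupp f)).

Definition lc (f : 'cV[A]_m) : R :=
  if lm f is Some X then coords (f X.2 0) X.1 else 0.

(* exp(lm(f)), for f <> 0 *)
Definition lexp (f : 'cV[A]_m) : 'X_{1..n} :=
  if lm f is Some X then X.1 else 0%MM.

Definition divides_via (g f : 'cV[A]_m) (a : 'X_{1..n}) : Prop :=
  exists X Y : vmon,
    [/\ lm g = Some X, lm f = Some Y, X.2 = Y.2 & (X.1 + a)%MM = Y.1].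

Definition reduces1 (F : {fset 'cV[A]_m}) (f h : 'cV[A]_m) : Prop :=
  (f = 0 /\ h = 0) \/
  f <> 0 /\
  exists (t : nat) (g : 'I_t -> 'cV[A]_m) (r : 'I_t -> R)
         (a : 'I_t -> 'X_{1..n}),
    [/\ forall j, g j \in F,
        forall j, divides_via (g j) f (a j),
        lc f = \sum_(j < t)
          lc (g j) * sigma_pow (lexp (g j)) (r j) * cmon (lexp (g j)) (a j)
      & h = f - \sum_(j < t) g j *m (iota (r j) * xmon (a j))%:M].

Definition reduces (F : {fset 'cV[A]_m}) : 'cV[A]_m -> 'cV[A]_m -> Prop :=
  clos_refl_trans _ (reduces1 F).

Definition reduced (F : {fset 'cV[A]_m}) (f : 'cV[A]_m) : Prop :=
  f = 0 \/ ~ exists h, reduces1 F f h.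

Definition reducible (F : {fset 'cV[A]_m}) (f : 'cV[A]_m) : Prop :=
  ~ reduced F f.

Definition grobner_basis (M : 'cV[A]_m -> Prop) (G : {fset 'cV[A]_m}) : Prop :=
  [/\ G <> fset0,
      forall g, g \in G -> g <> 0 /\ M g
    & forall f, f <> 0 -> M f -> reducible G f].

Definition vlcm (s : seq vmon) : option vmon :=
  if s is X :: _ then
    if all (fun Y : vmon => Y.2 == X.2) s
    then Some (\big[@mlcm n/0%MM]_(Y <- s) Y.1, X.2)
    else None
  else None.

(* X_S, for a set S of non-zero vectors *)
Definition lcm_lm (S : {fset 'cV[A]_m}) : option vmon :=
  vlcm (pmap lm (enum_fset S)).

(* gamma_j; the truncated subtraction is exact as exp(lm(g)) divides X_S *)
Definition cofactor_exp (X : vmon) (g : 'cV[A]_m) : 'X_{1..n} :=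
  (X.1 - lexp g)%MM.

Definition syz_row (S : {fset 'cV[A]_m}) (X : vmon) :
    'rV[R]_(size (enum_fset S)) :=
  \row_j (let g := (enum_fset S)`_j in
          lc g * cmon (lexp g) (cofactor_exp X g)).

Definition syz_comb (S : {fset 'cV[A]_m}) (X : vmon)
    (b : 'cV[R]_(size (enum_fset S))) : 'cV[A]_m :=
  \sum_(j < size (enum_fset S))
    let g := (enum_fset S)`_j in
    let c := cofactor_exp X g in
    g *m (iota (inv_fun (psi (lexp g) c) (b j 0)) * xmon c)%:M.

(* The right Buchberger algorithm is a non-deterministic transition system: the enumeration of D, the
   generating sets B_S and the reductions are arbitrary.
   - [While G G']: about to evaluate the loop test;
   - [ForSubsets G G' D]: the elements of the list D remain to be processed;
   - [ForSyzygies G G' D ps]: moreover the combinations ps, coming from the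
     elements of B_S for the current S (they do not depend on G'), remain to be
     reduced;
   - [Output G]: the algorithm has stopped. *)
Inductive state : Type :=
| While of {fset 'cV[A]_m} & {fset 'cV[A]_m}
| ForSubsets of {fset 'cV[A]_m} & {fset 'cV[A]_m} & seq {fset 'cV[A]_m}
| ForSyzygies of {fset 'cV[A]_m} & {fset 'cV[A]_m} & seq {fset 'cV[A]_m}
    & seq 'cV[A]_m
| Output of {fset 'cV[A]_m}.

Inductive step : state -> state -> Prop :=
| StepExit G : step (While G G) (Output G)
| StepEnter G G' D :
    G' <> G -> perm_eq D (enum_fset (fpowerset G' `\` fpowerset G)%fset) ->
    step (While G G') (ForSubsets G' G' D)
| StepSkip G G' S D :
    lcm_lm S = None ->
    step (ForSubsets G G' (S :: D)) (ForSubsets G G' D)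
| StepSubset G G' S D X (B : seq 'cV[R]_(size (enum_fset S))) :
    lcm_lm S = Some X -> rsyz_generators (syz_row S X) B ->
    step (ForSubsets G G' (S :: D))
         (ForSyzygies G G' D [seq syz_comb X b | b <- B])
| StepReduce G G' D p ps r :
    reduces G' p r -> reduced G' r ->
    step (ForSyzygies G G' D (p :: ps))
         (ForSyzygies G (if r == 0 then G' else (r |` G')%fset) D ps)
| StepNextSubset G G' D :
    step (ForSyzygies G G' D [::]) (ForSubsets G G' D)
| StepLoop G G' :
    step (ForSubsets G G' [::]) (While G G').

Definition initial (F : {fset 'cV[A]_m}) : state := While fset0 F.

Definition reachable (F : {fset 'cV[A]_m}) : state -> Prop :=
  clos_refl_trans _ step (initial F).

(* Every execution on input F is finite, never gets stuck before its output,
   and outputs some G satisfying P. *)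
Definition buchberger_produces (F : {fset 'cV[A]_m})
    (P : {fset 'cV[A]_m} -> Prop) : Prop :=
  [/\ ~ (exists run : nat -> state,
           run 0%N = initial F /\ forall k, step (run k) (run k.+1)),
      forall s, reachable F s ->
        (exists G, s = Output G) \/ (exists s', step s s')
    & forall G, reachable F (Output G) -> P G].

End Vectors.
End SkewPBW.

(* Main.v *)
From Stdlib Require Import Relation_Operators Operators_Properties.
From Stdlib Require Import ClassicalEpsilon Classical.
Require Import Defs.
From mathcomp Require Import all_boot all_order all_algebra.
From mathcomp Require Import finmap.
From mathcomp Require Import mpoly.
From mathcomp Require Import zify.

(** Let [g] be a vector with leading monomial x^b e_i. In a bijective skew PBW
    extension the product of [g] by the term r x^a on the right has no monomial
    above x^(b+a) e_i, and its coefficient there is lc(g) sigma^b(r) c_(b,a): commuting a coefficient with a monomial twists it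
    by the automorphism sigma^b, commuting two monomials produces the
    invertible constant c_(b,a), and every correction has smaller total degree,
    hence is smaller for the order ([vcoef_term]). The two families of
    constants are tied together by associativity ([cmon_cocycle]).

    Correctness is Buchberger's criterion ([buchberger_criterion]). Write an
    element [v] of the module as a sum of terms g (r x^a) with [g] in [G], so
    that the largest monomial X reached by the leading monomials of the
    summands is minimal. If the coefficient of X in the sum is not zero, it is
    lc(v), and the summands that reach X reduce [v]. If it is zero, let S be
    the set of those [g] in [G] whose leading monomial divides X. Then
    X = X_S x^d, and the cancellation at X is, up to the twists, a syzygy of the
    row that defines B_S. The twists are compatible because the inverse of
    psi_(b,a) is r |-> sigma^a (sigma^(-X_S) r), in which the inner part does
    not depend on the element of S ([inv_psi]). Expanding the syzygy on B_S
    replaces the summands that reach X by right multiples of the combinations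
    attached to B_S, up to terms below X ([syz_lift]). These combinations have
    representations below X_S, since the algorithm has reduced each of them to
    0 or to an element of [G]. So [v] has a representation below X, against the
    minimality of X; the order is well founded because it refines the degree
    ([lt_wf]).

    Termination. A vector added to [G'] is reduced with respect to [G'].
    Suppose that infinitely many are added. By Dickson's lemma some subsequence
    has leading monomials each dividing the next ([dickson]); as R is right
    Noetherian, one of the leading coefficients in it is a right combination of
    the earlier ones ([noetherian_sequence]), and the corresponding vector
    could have been reduced ([extends_wf]). Between two additions only finite
    work lists are consumed ([step_acc]). *)

Set Implicit Arguments.
Unset Strict Implicit.
Unset Printing Implicit Defensive.

Import GRing.Theory.
Local Open Scope ring_scope.

(** * Choice and inverses *)

Lemma the_spec (T : Type) (t0 : T) (P : T -> Prop) :
  (exists t, P t) -> P (the t0 P).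
Proof. exact: epsilon_spec. Qed.

Lemma fun_choice (S T : Type) (P : S -> T -> Prop) :
  (forall s, exists t, P s t) -> exists f : S -> T, forall s, P s (f s).
Proof.
move=> exP; exists (fun s => sval (constructive_indefinite_description _ (exP s))).
by move=> s; case: constructive_indefinite_description.
Qed.

Lemma inv_funP (T : pzRingType) (f : T -> T) :
  bijective f -> cancel f (inv_fun f) /\ cancel (inv_fun f) f.
Proof.
move=> [g fK gK].
have invK : cancel (inv_fun f) f.
  move=> y; apply: (@the_spec _ _ (fun z => f z = y)).
  by exists (g y); rewrite gK.
by split=> // z; apply: (can_inj fK); rewrite invK.
Qed.

Lemma invertibleM (T : pzRingType) (c d : T) :
  invertible c -> invertible d -> invertible (c * d).
Proof.
move=> [c' [cc' c'c]] [d' [dd' d'd]]; exists (d' * c'); split.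
  by rewrite mulrA -(mulrA c) dd' mulr1.
by rewrite mulrA -(mulrA d') c'c mulr1.
Qed.

(** * Right spans and multi-indices *)

Section RightSpan.
Variables (T : pzRingType) (k : nat) (s : seq 'cV[T]_k).

Lemma rspan_mem b : b \in s -> rspan s b.
Proof.
move=> bs; have lt_b : (index b s < size s)%N by rewrite index_mem.
exists (fun j => if j == Ordinal lt_b then 1 else 0).
rewrite (bigD1 (Ordinal lt_b)) //= eqxx mulmx1 nth_index // big1 ?addr0 // => j.
by move=> /negPf ->; rewrite raddf0 mulmx0.
Qed.

Lemma rspan0 : rspan s 0.
Proof. by exists (fun=> 0); rewrite big1 // => j _; rewrite raddf0 mulmx0. Qed.

Lemma rspanD u v : rspan s u -> rspan s v -> rspan s (u + v).
Proof.
move=> [c ->] [d ->]; exists (fun j => c j + d j); rewrite -big_split.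
by apply: eq_bigr => j _; rewrite raddfD mulmxDr.
Qed.

Lemma rspanM u a : rspan s u -> rspan s (u *m a%:M).
Proof.
move=> [c ->]; exists (fun j => c j * a); rewrite mulmx_suml.
by apply: eq_bigr => j _; rewrite -mulmxA -scalar_mxM.
Qed.

End RightSpan.

(** Induction that peels off the first variable occurring in a monomial.
    Since monomials are ordered products, and sigma^a is an ordered
    composition, this is the decomposition in which the factor removed stands
    at the far left of both. *)
Lemma mnm_head_ind (n : nat) (P : 'X_{1..n} -> Prop) :
  P 0%MM ->
  (forall (k : 'I_n) (a : 'X_{1..n}),
     (forall j : 'I_n, (j < k)%N -> a j = 0%N) ->
     P a -> P (U_(k) + a)%MM) ->
  forall a, P a.
Proof.
move=> P0 PS a; have [d] := ubnP (mdeg a); elim: d a => // d IHd a le_a_d.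
case: (eqVneq a 0%MM) => [-> //|a_neq0].
have [k0 ak0] : exists k : 'I_n, a k != 0%N.
  apply/existsP; rewrite -negb_forall; apply: contraNN a_neq0 => /forallP a0.
  by apply/eqP/mnmP => k; rewrite mnm0E; apply/eqP.
case: (@arg_minnP _ k0 (fun k => a k != 0%N) val ak0) => k ak kmin.
have ka : (U_(k) <= a)%MM by rewrite lep1mP.
move: le_a_d; rewrite -(submK ka) mdegD mdeg1 addn1 ltnS => le_a_d.
rewrite addmC; apply: PS; last exact: IHd.
move=> j lt_jk; rewrite mnmBE; case: (eqVneq (a j) 0%N) => [-> //|/kmin].
by rewrite leqNgt lt_jk.
Qed.

(** Common core of [monS] and [sigma_powS]: both the ordered product and the
    ordered composition are iterated operators over the increasing list of
    variables, and raising the exponent of [k] adds one factor at the head as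
    no variable before [k] occurs. *)
Lemma foldr_head (I : eqType) (V : Type) (ord : rel I) (s : seq I)
    (e e' : I -> nat) (h : I -> V -> V) (k : I) (v : V) :
  irreflexive ord -> transitive ord -> sorted ord s -> k \in s ->
  (forall j, ord j k -> e j = 0%N) -> (forall j, e' j = (k == j) + e j)%N ->
  foldr (fun i w => iter (e' i) (h i) w) v s
  = h k (foldr (fun i w => iter (e i) (h i) w) v s).
Proof.
move=> ord_irr ord_tr; elim: s => // j s IHs /= path_js k_js e0 e'E.
have sort_s : sorted ord s by exact: path_sorted path_js.
rewrite e'E; case: (eqVneq k j) => [k_j | k_neq_j].
  rewrite add1n iterS k_j; congr (h j (iter _ _ _)).
  have nj_s : j \notin s.
    have := order_path_min ord_tr path_js; apply: contraTN => j_s.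
    by apply/allPn; exists j; rewrite ?ord_irr.
  elim: s nj_s {IHs path_js k_js sort_s} => //= i s IHs.
  by rewrite inE negb_or e'E k_j => /andP[/negPf-> /IHs->].
have k_s : k \in s by move: k_js; rewrite inE (negPf k_neq_j).
rewrite IHs // e0 ?addn0 //.
exact: (allP (order_path_min ord_tr path_js)).
Qed.

(** * Dickson's lemma and ascending chains *)

Lemma acc_of_no_descent (T : Type) (r : T -> T -> Prop) (t : T) :
  ~ (exists u : nat -> T, u 0%N = t /\ forall k, r (u k.+1) (u k)) -> Acc r t.
Proof.
move=> no_descent; apply: NNPP => not_acc; apply: no_descent.
have next (p : {t | ~ Acc r t}) : exists q : {t | ~ Acc r t}, r (sval q) (sval p).
  apply: NNPP => stuck; apply: (svalP p); constructor=> q rqp.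
  by apply: NNPP => nq; apply: stuck; exists (exist _ q nq).
have [f fP] := fun_choice next.
by exists (fun k => sval (iter k f (exist _ t not_acc))); split=> // k; exact: fP.
Qed.

Lemma no_descent_of_acc (T : Type) (r : T -> T -> Prop) (t : T) :
  Acc r t -> ~ (exists u : nat -> T, u 0%N = t /\ forall k, r (u k.+1) (u k)).
Proof.
elim=> {}t _ IHt [u [u0 ru]]; apply: (IHt (u 1%N)); first by rewrite -u0.
by exists (fun k => u k.+1).
Qed.

(** Each term of the subsequence is a minimum of a tail of [u]. *)
Lemma monotone_subsequence (u : nat -> nat) :
  exists phi : nat -> nat, {homo phi : i j / (i < j)%N} /\
    {homo u \o phi : i j / (i <= j)%N}.
Proof.
have tail_min k : exists p, (k <= p)%N /\ forall q, (k <= q)%N -> (u p <= u q)%N.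
  suff H N p : (k <= p)%N -> (u p < N)%N ->
      exists p, (k <= p)%N /\ forall q, (k <= q)%N -> (u p <= u q)%N.
    exact: (H (u k).+1 k).
  elim: N p => // N IHN p le_kp; rewrite ltnS => le_pN.
  case: (classic (forall q, (k <= q)%N -> (u p <= u q)%N)) => [|nmin]; first by exists p.
  have [q nq] := not_all_ex_not _ _ nmin; have [le_kq /negP] := imply_to_and _ _ nq.
  by rewrite -ltnNge => lt_qp; apply: (IHN q) => //; exact: leq_trans le_pN.
have [f fP] := fun_choice tail_min.
pose phi := fix phi k := if k is k'.+1 then f (phi k').+1 else f 0%N.
have phiS k : (phi k < phi k.+1)%N by have [] := fP (phi k).+1.
exists phi; split; first exact: homo_ltn ltn_trans phiS.
(* [phi k] is a minimum of the tail starting at some [p], and [phi k.+1]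
   belongs to that tail. *)
apply: homo_leq leqnn leq_trans _ => k /=.
have [p [phiE le_p]] : exists p, phi k = f p /\ (p <= phi k)%N.
  case: k => [|k]; first by exists 0%N.
  by exists (phi k).+1; split=> //; exact: phiS.
rewrite [in leqLHS]phiE; apply: (proj2 (fP p)).
exact: leq_trans le_p (ltnW (phiS k)).
Qed.

Lemma common_monotone_subsequence (I : eqType) (s : seq I) (u : I -> nat -> nat) :
  exists phi : nat -> nat, {homo phi : i j / (i < j)%N} /\
    forall i, i \in s -> {homo u i \o phi : k l / (k <= l)%N}.
Proof.
elim: s => [|i s [phi [phi_lt u_phi]]]; first by exists id; split.
have [chi [chi_lt ui_chi]] := monotone_subsequence (u i \o phi).
have chi_le : {homo chi : k l / (k <= l)%N}.
  by move=> k l; rewrite leq_eqVlt => /predU1P[-> // | /chi_lt /ltnW].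
exists (phi \o chi); split=> [k l /chi_lt /phi_lt //|j].
rewrite inE => /predU1P[-> // | /u_phi uj_phi] k l le_kl.
exact: (uj_phi _ _ (chi_le _ _ le_kl)).
Qed.

(** One passes to a common monotone subsequence of the n exponents and of the
    two numbers i and m - i, where i is the index of the monomial: when both
    are nondecreasing, i is constant. *)
Lemma dickson (n m : nat) (X : nat -> 'X_{1..n} * 'I_m) :
  exists phi : nat -> nat, {homo phi : k l / (k < l)%N} /\
    forall k l, (k <= l)%N ->
      ((X (phi k)).1 <= (X (phi l)).1)%MM /\ (X (phi k)).2 = (X (phi l)).2.
Proof.
pose u (i : 'I_n + bool) (k : nat) : nat := match i with
  | inl i => (X k).1 i
  | inr b => if b then (X k).2 : nat else (m - (X k).2)%N
  end.
have [phi [phi_lt u_phi]] := common_monotone_subsequence (enum {: 'I_n + bool}) u.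
exists phi; split=> // k l le_kl; split.
  apply/mnm_lepP => i; exact: (u_phi (inl i) (mem_enum _ _) _ _ le_kl).
have /= le1 := u_phi (inr true) (mem_enum _ _) _ _ le_kl.
have /= le2 := u_phi (inr false) (mem_enum _ _) _ _ le_kl.
apply: val_inj => /=.
by move: le1 le2 (ltn_ord (X (phi k)).2) (ltn_ord (X (phi l)).2); lia.
Qed.

(** The right ideals generated by the first k terms form an ascending chain,
    which stabilizes at some N. *)
Lemma noetherian_sequence (T : pzRingType) (c : nat -> T) :
  right_noetherian T ->
  exists N (r : 'I_N -> T), c N = \sum_(i < N) c i * r i.
Proof.
pose I k a := exists r : nat -> T, a = \sum_(i < k) c i * r i.
case/(_ I) => [k|k a [r ->]|N I_N].
- split; first by exists (fun=> 0); rewrite big1 // => i _; rewrite mulr0.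
    move=> a b [r ->] [s ->]; exists (fun i => r i + s i); rewrite -big_split.
    by apply: eq_bigr => i _; rewrite mulrDr.
  move=> a b [r ->]; exists (fun i => r i * b); rewrite mulr_suml.
  by apply: eq_bigr => i _; rewrite mulrA.
- exists (fun i => if (i < k)%N then r i else 0); rewrite big_ord_recr /=.
  by rewrite ltnn mulr0 addr0; apply: eq_bigr => i _; rewrite ltn_ord.
have [|r cN] := I_N N.+1 (c N) (leqnSn N).
  exists (fun i => if i == N then 1 else 0); rewrite big_ord_recr /= eqxx mulr1.
  by rewrite big1 ?add0r // => i _; rewrite ltn_eqF ?mulr0.
by exists N, (fun i => r i).
Qed.

(** * Coordinates in a skew PBW extension *)

Section PBW.
Variables (R A : pzRingType) (iota : {rmorphism R -> A}).
Variables (n : nat) (x : 'I_n -> A).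
Hypothesis hA : skew_PBW iota x.

Implicit Types (f g h p : A) (r s : R) (a b : 'X_{1..n}) (i j k : 'I_n).

Local Notation mon := (xmon x).
Local Notation coords := (coords iota x).
Local Notation lincomb := (lincomb iota x).
Local Notation sigma := (sigma iota x).
Local Notation sigma_pow := (sigma_pow iota x).
Local Notation cmon := (cmon iota x).

Lemma coordsK f : f = lincomb (coords f).
Proof.
have [_ /(_ f) [c [fc _]] _ _] := hA.
by apply: (@the_spec _ _ (fun c => f = lincomb c)); exists c.
Qed.

Lemma coords_lincomb c : coords (lincomb c) = c.
Proof.
have [_ /(_ (lincomb c)) [c' [_ c'_uniq]] _ _] := hA.
exact: etrans (esym (c'_uniq _ (coordsK _))) (c'_uniq c erefl).
Qed.

(** The list of monomials may be any that contains the support; this is what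
    allows two elements to be expanded over the same list. *)
Lemma lincomb_big (c : {fsfun 'X_{1..n} -> R with 0}) (s : seq 'X_{1..n}) :
  uniq s -> {subset finsupp c <= s} ->
  lincomb c = \sum_(a <- s) iota (c a) * mon a.
Proof.
move=> uniq_s sub_s; rewrite /Defs.lincomb.
rewrite [RHS](bigID (fun a => a \in finsupp c)) /= [X in _ = _ + X]big1 ?addr0.
  rewrite -[RHS]big_filter; apply: perm_big; apply: uniq_perm.
  - exact: fset_uniq.
  - exact: filter_uniq.
  - move=> a; rewrite mem_filter; case: (boolP (a \in finsupp c)) => //= /sub_s.
    by move->.
by move=> a /fsfun_dflt ->; rewrite rmorph0 mul0r.
Qed.

Lemma coords_sum_mon (s : seq 'X_{1..n}) (h : 'X_{1..n} -> R) b :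
  uniq s ->
  coords (\sum_(a <- s) iota (h a) * mon a) b = if b \in s then h b else 0.
Proof.
move=> uniq_s; pose c := [fsfun a in [fset a | a in s]%fset => h a]
  : {fsfun 'X_{1..n} -> R with 0}.
have cE a : c a = if a \in s then h a else 0.
  by rewrite fsfunE; rewrite in_fset /=.
rewrite -cE -(coords_lincomb c); congr (coords _ b).
rewrite (@lincomb_big c s) //.
  by rewrite [LHS]big_seq [RHS]big_seq; apply: eq_bigr => a a_s; rewrite cE a_s.
by move=> a; rewrite mem_finsupp cE; case: ifP => // _; rewrite eqxx.
Qed.

Lemma coords_sum_supp f (s : seq 'X_{1..n}) :
  uniq s -> {subset finsupp (coords f) <= s} ->
  f = \sum_(a <- s) iota (coords f a) * mon a.
Proof. by move=> s_uniq s_sub; rewrite {1}(coordsK f); exact: lincomb_big. Qed.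

Lemma coordsD f g b : coords (f + g) b = coords f b + coords g b.
Proof.
pose s := undup ((finsupp (coords f) : seq _) ++ finsupp (coords g)).
have s_uniq : uniq s by exact: undup_uniq.
have fs : {subset finsupp (coords f) <= s}.
  by move=> a af; rewrite mem_undup mem_cat af.
have gs : {subset finsupp (coords g) <= s}.
  by move=> a ag; rewrite mem_undup mem_cat ag orbT.
rewrite [in LHS](coords_sum_supp s_uniq fs) [in LHS](coords_sum_supp s_uniq gs).
rewrite -big_split /=; under eq_bigr do rewrite -mulrDl -rmorphD.
rewrite coords_sum_mon //; case: ifPn => // b_s.
by rewrite !fsfun_dflt ?addr0 //; apply: contraNN b_s; [exact: gs | exact: fs].
Qed.

Lemma coordsZ r f b : coords (iota r * f) b = r * coords f b.
Proof.
have s_uniq : uniq (finsupp (coords f)) by exact: fset_uniq.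
rewrite [in LHS](@coords_sum_supp f (finsupp (coords f))) // big_distrr /=.
under eq_bigr do rewrite mulrA -rmorphM.
by rewrite coords_sum_mon //; case: finsuppP => //; rewrite mulr0.
Qed.

Lemma coords0 b : coords 0 b = 0.
Proof. by have := coordsZ 0 0 b; rewrite rmorph0 !mul0r. Qed.

Lemma coordsN f b : coords (- f) b = - coords f b.
Proof. by apply/eqP; rewrite -addr_eq0 -coordsD addNr coords0. Qed.

Lemma coords_sum (I : Type) (s : seq I) (P : pred I) (F : I -> A) b :
  coords (\sum_(i <- s | P i) F i) b = \sum_(i <- s | P i) coords (F i) b.
Proof.
apply: (big_morph (fun f => coords f b)) => [f g|]; first exact: coordsD.
exact: coords0.
Qed.

Lemma coords_term r a b :
  coords (iota r * mon a) b = if b == a then r else 0.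
Proof.
have := @coords_sum_mon [:: a] (fun=> r) b isT.
by rewrite big_seq1 inE.
Qed.

Lemma coords_inj f g : (forall a, coords f a = coords g a) -> f = g.
Proof. by move=> fg; rewrite (coordsK f) (coordsK g); congr lincomb; apply/fsfunP. Qed.

Definition supported (P : 'X_{1..n} -> Prop) f : Prop :=
  forall a, coords f a != 0 -> P a.

Lemma supported_weaken (P Q : 'X_{1..n} -> Prop) f :
  (forall a, P a -> Q a) -> supported P f -> supported Q f.
Proof. by move=> PQ Pf a /Pf /PQ. Qed.

Lemma supported0 P : supported P 0.
Proof. by move=> a; rewrite coords0 eqxx. Qed.

Lemma supportedD P f g : supported P f -> supported P g -> supported P (f + g).
Proof.
move=> Pf Pg a; rewrite coordsD; case: (eqVneq (coords f a) 0) => [->|/Pf //].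
by rewrite add0r => /Pg.
Qed.

Lemma supportedN P f : supported P f -> supported P (- f).
Proof. by move=> Pf a; rewrite coordsN oppr_eq0 => /Pf. Qed.

Lemma supported_sum P (I : Type) (s : seq I) (Q : pred I) (F : I -> A) :
  (forall i : I, Q i -> supported P (F i)) -> supported P (\sum_(i <- s | Q i) F i).
Proof.
move=> PF; elim/big_rec: _ => [|i f Qi Pf]; first exact: supported0.
by apply: supportedD => //; exact: PF.
Qed.

Lemma supportedZ P r f : supported P f -> supported P (iota r * f).
Proof.
move=> Pf a; rewrite coordsZ; case: (eqVneq (coords f a) 0) => [->|/Pf //].
by rewrite mulr0 eqxx.
Qed.

Lemma supported_term (P : 'X_{1..n} -> Prop) r a :
  P a -> supported P (iota r * mon a).
Proof.
move=> Pa b; rewrite coords_term; case: (eqVneq b a) => [-> // | _].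
by rewrite eqxx.
Qed.

(** A statement about [f] that is stable under sums need only be checked on
    the terms of [f]. *)
Lemma supported_ind (P : 'X_{1..n} -> Prop) (Q : A -> Prop) f :
  Q 0 -> (forall g h, Q g -> Q h -> Q (g + h)) ->
  (forall r a, P a -> Q (iota r * mon a)) ->
  supported P f -> Q f.
Proof.
move=> Q0 QD QT Pf; rewrite (coordsK f) /Defs.lincomb big_seq.
apply: (big_ind Q) => // a; rewrite mem_finsupp => /Pf; exact: QT.
Qed.

(** * The degree filtration *)

(** With a strict bound, [low 0] holds of 0 only, and the product of an
    element of degree p by one of [low q] is in [low (p + q)]. *)
Definition low (d : nat) f : Prop := supported (fun a => (mdeg a < d)%N) f.

(** Congruence modulo lower degree. All computations with monomials below are
    made modulo terms that are smaller for the order. *)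
Definition cong (d : nat) f g : Prop := low d (f - g).

Lemma low_weaken d e f : (d <= e)%N -> low d f -> low e f.
Proof. by move=> de; apply: supported_weaken => a /leq_trans; exact. Qed.

Lemma low_coords d f a : low d f -> (d <= mdeg a)%N -> coords f a = 0.
Proof. by move=> lf; rewrite leqNgt; case: (eqVneq (coords f a) 0) => // /lf ->. Qed.

Lemma low0_eq0 f : low 0 f -> f = 0.
Proof.
by move=> f0; apply: coords_inj => a; rewrite coords0 (low_coords f0).
Qed.

Lemma cong_refl d f : cong d f f.
Proof. by rewrite /cong subrr; exact: supported0. Qed.

Lemma cong_sym d f g : cong d f g -> cong d g f.
Proof. by rewrite /cong => /supportedN; rewrite opprB. Qed.

Lemma cong_trans d g f h : cong d f g -> cong d g h -> cong d f h.
Proof. by rewrite /cong => fg gh; rewrite -(subrKA g f); exact: supportedD. Qed.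

Lemma cong_weaken d e f g : (d <= e)%N -> cong d f g -> cong e f g.
Proof. exact: low_weaken. Qed.

Lemma congZ d r f g : cong d f g -> cong d (iota r * f) (iota r * g).
Proof. by rewrite /cong -mulrBr; exact: supportedZ. Qed.

Lemma cong_coords d f g a : cong d f g -> (d <= mdeg a)%N -> coords f a = coords g a.
Proof.
move=> fg da; apply/eqP; rewrite -subr_eq0 -coordsN -coordsD.
by rewrite (low_coords fg).
Qed.

Lemma cong_low d f g : cong d f g -> low d g -> low d f.
Proof. by move=> fg lg; rewrite -(subrK g f); exact: supportedD. Qed.

(** * Monomials and the twisting maps *)

Lemma mon0 : mon 0%MM = 1.
Proof. by rewrite /xmon big1 // => i _; rewrite mnm0E. Qed.

Lemma sigma_pow0 r : sigma_pow 0%MM r = r.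
Proof. by rewrite /Defs.sigma_pow; elim: (enum _) => //= i s ->; rewrite mnm0E. Qed.

Lemma enum_ord_sorted : sorted (fun i j : 'I_n => (i < j)%N) (enum 'I_n).
Proof.
rewrite -(@sorted_map _ _ val ltn) val_enum_ord; exact: iota_ltn_sorted.
Qed.

Lemma monS k a : (forall j, (j < k)%N -> a j = 0%N) ->
  mon (U_(k) + a)%MM = x k * mon a.
Proof.
move=> a0.
have monE b : mon b = foldr (fun i p => iter (b i) ( *%R (x i)) p) 1 (enum 'I_n).
  have -> : mon b = \prod_(i <- enum 'I_n) x i ^+ b i.
    by rewrite /xmon enumT; congr (bigop _ _ _); rewrite /index_enum unlock.
  elim: (enum _) => [|i s IHs]; first exact: big_nil.
  by rewrite big_cons IHs /= -[X in _ * X]mul1r mulrA mulr1 iter_mulr.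
rewrite !monE (@foldr_head _ _ (fun i j : 'I_n => (i < j)%N) _ a _ _ k) //.
- by move=> i; rewrite ltnn.
- by move=> i j l; exact: ltn_trans.
- exact: enum_ord_sorted.
- by rewrite mem_enum.
- by move=> j; rewrite mnmDE mnm1E.
Qed.

(** The composition sigma^a is built in the same order as the monomial x^a. *)
Lemma sigma_powS k a r : (forall j, (j < k)%N -> a j = 0%N) ->
  sigma_pow (U_(k) + a)%MM r = sigma k (sigma_pow a r).
Proof.
move=> a0; rewrite /Defs.sigma_pow.
rewrite (@foldr_head _ _ (fun i j : 'I_n => (i < j)%N) _ a _ _ k) //.
- by move=> i; rewrite ltnn.
- by move=> i j l; exact: ltn_trans.
- exact: enum_ord_sorted.
- by rewrite mem_enum.
- by move=> j; rewrite mnmDE mnm1E.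
Qed.

Lemma mon1 k : mon U_(k)%MM = x k.
Proof. by rewrite -[U_(k)%MM]addm0 monS ?mon0 ?mulr1 // => j _; rewrite mnm0E. Qed.

Lemma mulx_iota i r : exists d, x i * iota r = iota (sigma i r) * x i + iota d.
Proof.
have [_ _ hx _] := hA.
apply: (@the_spec _ _ (fun s => exists d, x i * iota r = iota s * x i + iota d)).
case: (eqVneq r 0) => [->|/(hx i) [c [d [_ cd]]]].
  by exists 0, 0; rewrite !rmorph0 mulr0 mul0r addr0.
by exists c, d; rewrite -cd addrC subrK.
Qed.

(** By freeness, the coordinate at x_i of s x_i + d is s. *)
Lemma sigma_unique i r s d :
  x i * iota r = iota s * x i + iota d -> sigma i r = s.
Proof.
have coords_i t e : coords (iota t * x i + iota e) U_(i)%MM = t.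
  rewrite coordsD -mon1 coords_term eqxx -[iota e]mulr1 -mon0 coords_term.
  by rewrite mnm1_eq0 addr0.
have [d' ->] := mulx_iota i r; move=> eq_sd.
by rewrite -(coords_i (sigma i r) d') eq_sd coords_i.
Qed.

Lemma sigmaD i r s : sigma i (r + s) = sigma i r + sigma i s.
Proof.
have [[d rE] [e sE]] := (mulx_iota i r, mulx_iota i s).
apply: (@sigma_unique _ _ _ (d + e)).
by rewrite [iota (r + s)]rmorphD mulrDr rE sE !rmorphD mulrDl addrACA.
Qed.

Lemma sigmaM i r s : sigma i (r * s) = sigma i r * sigma i s.
Proof.
have [[d rE] [e sE]] := (mulx_iota i r, mulx_iota i s).
apply: (@sigma_unique _ _ _ (sigma i r * e + d * s)).
rewrite rmorphM mulrA rE mulrDl -mulrA sE mulrDr !rmorphD !rmorphM.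
by rewrite !mulrA addrA.
Qed.

Lemma sigma1 i : sigma i 1 = 1.
Proof. by apply: (@sigma_unique _ _ _ 0); rewrite rmorph0 !rmorph1 mulr1 mul1r addr0. Qed.

Lemma sigma_powD a r s : sigma_pow a (r + s) = sigma_pow a r + sigma_pow a s.
Proof.
elim/mnm_head_ind: a => [|k a a0 IHa]; first by rewrite !sigma_pow0.
by rewrite !sigma_powS // IHa sigmaD.
Qed.

Lemma sigma_powM a r s : sigma_pow a (r * s) = sigma_pow a r * sigma_pow a s.
Proof.
elim/mnm_head_ind: a => [|k a a0 IHa]; first by rewrite !sigma_pow0.
by rewrite !sigma_powS // IHa sigmaM.
Qed.

Lemma sigma_pow1 a : sigma_pow a 1 = 1.
Proof.
elim/mnm_head_ind: a => [|k a a0 IHa]; first by rewrite sigma_pow0.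
by rewrite sigma_powS // IHa sigma1.
Qed.

Lemma sigma_pow_r0 a : sigma_pow a 0 = 0.
Proof. by apply: (addrI (sigma_pow a 0)); rewrite -sigma_powD !addr0. Qed.

(** * Products of terms *)

Hypothesis hbij : bijective_PBW iota x.

Lemma sigma_pow_bij a : bijective (sigma_pow a).
Proof.
elim/mnm_head_ind: a => [|k a a0 IHa].
  by exists id => r; rewrite sigma_pow0.
have [g gK Kg] := bij_comp (proj1 hbij k) IHa.
by exists g => r /=; rewrite ?sigma_powS // ?gK //; have := Kg r; rewrite /= -sigma_powS.
Qed.

Lemma sigma_invertible i c : invertible c -> invertible (sigma i c).
Proof.
by move=> [d [cd dc]]; exists (sigma i d); rewrite -!sigmaM cd dc sigma1.
Qed.

(** Multiplication by x_i raises degrees by one at most: x_i r x^a =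
    sigma_i(r) x_i x^a + delta_i(r) x^a. The hypothesis isolates what has to
    be known on monomials, so that the lemma can serve inside the induction
    of [mulx_mon] before it is available in general as [mulx_low]. *)
Lemma mulx_low_of d i :
  (forall a, (mdeg a < d)%N -> low (mdeg a).+2 (x i * mon a)) ->
  forall f, low d f -> low d.+1 (x i * f).
Proof.
move=> xmonP f; apply: (@supported_ind _ (fun f => low d.+1 (x i * f))).
- by rewrite mulr0; exact: supported0.
- by move=> g h lg lh; rewrite mulrDr; exact: supportedD.
move=> r a lt_ad; have [e rE] := mulx_iota i r.
rewrite mulrA rE mulrDl -mulrA; apply: supportedD; apply: supportedZ.
  by apply: low_weaken (xmonP _ lt_ad); rewrite ltnS.
by rewrite -[mon a]mul1r -(rmorph1 iota); apply: supported_term; exact: ltnW.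
Qed.

(** This is the rewriting of a word into an ordered monomial. If x_i comes
    after the first variable x_k of the monomial, the commutation relation
    gives x_i x_k = c x_k x_i + lower; the induction on the degree applies to
    x_i times the rest, and x_k is then in front. *)
Lemma mulx_mon i a :
  exists c : R, invertible c /\ cong (mdeg a).+1 (x i * mon a) (iota c * mon (U_(i) + a)%MM).
Proof.
have [d] := ubnP (mdeg a); elim: d i a => // d IHd i a.
have inv1 : invertible (1 : R) by exists 1; rewrite mulr1.
elim/mnm_head_ind: a => [|k a a0 _] le_ad.
  exists 1; split=> //; rewrite mon0 addm0 mon1 rmorph1 mulr1 mul1r.
  exact: cong_refl.
have a'0 j : (j < k)%N -> (U_(i) + a)%MM j = (i == j) :> nat.
  by move=> lt_jk; rewrite mnmDE mnm1E a0 // addn0.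
have dE : mdeg (U_(k) + a) = (mdeg a).+1 by rewrite mdegD mdeg1.
have lt_ad : (mdeg a < d)%N by rewrite -ltnS -dE.
(* [x i] is already in front of the first variable of the monomial *)
case: (leqP i k) => [le_ik | lt_ki].
  exists 1; split=> //; rewrite rmorph1 mul1r [mon (U_(i) + _)%MM]monS.
    exact: cong_refl.
  move=> j lt_ji; rewrite mnmDE mnm1E a0 ?(leq_trans lt_ji) // addn0.
  by apply/eqP; rewrite eqb0 -val_eqE /= neq_ltn (leq_trans lt_ji) ?orbT.
have xlow j b : (mdeg b < d)%N -> low (mdeg b).+2 (x j * mon b).
  move=> lt_bd; have [c [_ cE]] := IHd j b lt_bd.
  apply: cong_low (cong_weaken _ cE) _ => //.
  by apply: supported_term; rewrite mdegD mdeg1.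
have [c [[c0 [d0 [e xx]]] c_inv]] := proj2 hbij k i.
have [c' [c'_inv c'E]] := IHd i a lt_ad.
exists (c * sigma k c'); split; first by
  apply: invertibleM => //; exact: sigma_invertible.
rewrite dE monS //.
have -> : x i * (x k * mon a)
  = iota c * (x k * (x i * mon a)) + (iota d0 * mon a
    + \sum_(l < n) iota (e l) * (x l * mon a)).
  move/eqP: xx; rewrite subr_eq => /eqP xx; rewrite mulrA xx mulrDl addrC.
  rewrite !mulrA mulrDl mulr_suml; congr (_ + (_ + _)).
  by apply: eq_bigr => l _; rewrite mulrA.
apply: (@cong_trans _ (iota c * (x k * (x i * mon a)))).
  rewrite /cong addrC addKr; apply: supportedD; first by exact: supported_term.
  by apply: supported_sum => l _; apply: supportedZ; exact: xlow.
rewrite rmorphM -mulrA; apply: congZ.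
have [t tE] := mulx_iota k c'.
apply: (@cong_trans _ (x k * (iota c' * mon (U_(i) + a)%MM))).
  rewrite /cong -mulrBr; apply: mulx_low_of c'E => b.
  by rewrite ltnS => le_ba; apply: xlow; exact: leq_ltn_trans lt_ad.
have -> : (U_(i) + (U_(k) + a) = U_(k) + (U_(i) + a))%MM by rewrite !addmA (addmC U_(i)%MM).
rewrite mulrA tE mulrDl -mulrA (@monS k); last first.
  move=> j lt_jk; rewrite a'0 //; apply/eqP; rewrite eqb0 -val_eqE /= neq_ltn.
  by rewrite (ltn_trans lt_jk) ?orbT.
by rewrite /cong addrC addKr; apply: supported_term; rewrite mdegD mdeg1.
Qed.

Lemma mulx_low i d f : low d f -> low d.+1 (x i * f).
Proof.
apply: mulx_low_of => a _; have [c [_ cE]] := mulx_mon i a.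
apply: cong_low (cong_weaken _ cE) _ => //.
by apply: supported_term; rewrite mdegD mdeg1.
Qed.

(** Moves a term through a monomial, one variable at a time. The constant
    does not depend on [r], which is how it is identified with c_(a,b), the
    case [r = 1]. *)
Lemma mon_term_ex a b :
  exists c : R, invertible c /\ forall r,
    cong (mdeg (a + b)) (mon a * (iota r * mon b))
      (iota (sigma_pow a r * c) * mon (a + b)%MM).
Proof.
elim/mnm_head_ind: a => [|k a a0 [c [c_inv cE]]].
  exists 1; split=> [|r]; first by exists 1; rewrite mulr1.
  by rewrite mon0 mul1r add0m sigma_pow0 mulr1; exact: cong_refl.
have [c' [c'_inv c'E]] := mulx_mon k (a + b)%MM.
exists (sigma k c * c'); split=> [|r].
  by apply: invertibleM => //; exact: sigma_invertible.
rewrite monS // -mulrA -addmA mdegD mdeg1 add1n sigma_powS //.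
apply: (@cong_trans _ (x k * (iota (sigma_pow a r * c) * mon (a + b)%MM))).
  by rewrite /cong -mulrBr; apply: mulx_low; exact: cE.
rewrite (mulrA (sigma k _)) -sigmaM [iota (sigma _ _ * _)]rmorphM
  -[X in cong _ _ X]mulrA [x k * _]mulrA.
have [t ->] := mulx_iota k (sigma_pow a r * c).
rewrite mulrDl -mulrA; apply: cong_trans _ (congZ c'E).
by rewrite /cong addrC addKr; exact: supported_term.
Qed.

(** Bridge between the degree, which is 0 on the zero element, and the
    filtration. *)
Lemma deg_low p d : p = 0 \/ (deg iota x p < d)%N <-> low d p.
Proof.
split=> [[-> | lt_pd] a | lp]; first by rewrite coords0 eqxx.
  rewrite -mem_finsupp => a_p; apply: leq_ltn_trans lt_pd.
  exact: (@leq_bigmax_seq _ _ xpredT mdeg).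
case: (eqVneq p 0) => [|p_neq0]; [by left | right].
have d_gt0 : (0 < d)%N.
  by case: d lp => // /low0_eq0 p0; rewrite p0 eqxx in p_neq0.
rewrite -(prednK d_gt0) ltnS; apply/bigmax_leqP_seq => a.
by rewrite mem_finsupp => /lp; rewrite -{1}(prednK d_gt0).
Qed.

Lemma mon_term a b r :
  cong (mdeg (a + b)) (mon a * (iota r * mon b))
    (iota (sigma_pow a r * cmon a b) * mon (a + b)%MM).
Proof.
have [c [_ cE]] := mon_term_ex a b; suff -> : cmon a b = c by exact: cE.
have {}cE : cong (mdeg (a + b)) (mon a * mon b) (iota c * mon (a + b)%MM).
  by have := cE 1; rewrite rmorph1 mul1r sigma_pow1 mul1r.
have [p [pE /deg_low p_low]] : exists p,
    mon a * mon b = iota (cmon a b) * mon (a + b)%MM + p /\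
    (p = 0 \/ (deg iota x p < mdeg (a + b))%N).
  apply: (@the_spec _ _ (fun c => exists p,
    mon a * mon b = iota c * mon (a + b)%MM + p /\
    (p = 0 \/ (deg iota x p < mdeg (a + b))%N))).
  exists c, (mon a * mon b - iota c * mon (a + b)%MM).
  by split; [rewrite addrC subrK | apply/deg_low].
have := cong_coords cE (leqnn _); rewrite pE coordsD !coords_term eqxx.
by rewrite (low_coords p_low) // addr0.
Qed.

Lemma cmon_invertible a b : invertible (cmon a b).
Proof.
have [c [c_inv cE]] := mon_term_ex a b; suff -> : cmon a b = c by [].
have := cong_coords (cong_trans (cong_sym (cE 1)) (@mon_term a b 1)) (leqnn _).
by rewrite !coords_term eqxx sigma_pow1 !mul1r.
Qed.

Lemma term_term a b r s :
  cong (mdeg (a + b)) ((iota s * mon a) * (iota r * mon b))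
    (iota (s * sigma_pow a r * cmon a b) * mon (a + b)%MM).
Proof.
by rewrite -mulrA -[s * _ * _]mulrA [iota (s * _)]rmorphM -[X in cong _ _ X]mulrA;
  apply: congZ; exact: mon_term.
Qed.

Lemma lowM (p q : nat) f g : low p f -> low q.+1 g -> low (p + q) (f * g).
Proof.
move=> lf lg; apply: (@supported_ind _ (fun f => low (p + q) (f * g)) _ _ _ _ lf).
- by rewrite mul0r; exact: supported0.
- by move=> f1 f2 l1 l2; rewrite mulrDl; exact: supportedD.
move=> s a lt_ap.
apply: (@supported_ind _ (fun g => low (p + q) (iota s * mon a * g)) _ _ _ _ lg).
- by rewrite mulr0; exact: supported0.
- by move=> g1 g2 l1 l2; rewrite mulrDr; exact: supportedD.
move=> r b lt_bq; have le_ab : (mdeg (a + b) < p + q)%N.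
  by rewrite mdegD -addSn; exact: leq_add.
apply: cong_low (cong_weaken (ltnW le_ab) (@term_term _ _ _ _)) _.
exact: supported_term.
Qed.

Lemma lowMr (p q : nat) f g : low p.+1 f -> low q g -> low (p + q) (f * g).
Proof.
case: q => [_ /low0_eq0 -> | q lf lg]; first by rewrite mulr0; exact: supported0.
by rewrite addnS -addSn; exact: lowM.
Qed.

Lemma cong_mull (p q : nat) f g h : low p.+1 f -> cong q g h -> cong (p + q) (f * g) (f * h).
Proof. by move=> lf gh; rewrite /cong -mulrBr; exact: lowMr. Qed.

Lemma cong_mulr (p q : nat) f g h : low q.+1 h -> cong p f g -> cong (p + q) (f * h) (g * h).
Proof. by move=> lh fg; rewrite /cong -mulrBl; exact: lowM. Qed.

Lemma low_term r a : low (mdeg a).+1 (iota r * mon a).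
Proof. exact: supported_term. Qed.

Lemma low_mon a : low (mdeg a).+1 (mon a).
Proof. by rewrite -[mon a]mul1r -(rmorph1 iota); exact: low_term. Qed.

(** Both sides are the coefficient of x^(a+b+e) in x^a x^b s x^e, computed
    with the two ways of associating the product. *)
Lemma cmon_cocycle a b e s :
  sigma_pow a (sigma_pow b s * cmon b e) * cmon a (b + e)%MM
  = cmon a b * sigma_pow (a + b)%MM s * cmon (a + b)%MM e.
Proof.
set l := LHS; set r := RHS.
have lE : cong (mdeg (a + (b + e))) (mon a * (mon b * (iota s * mon e)))
    (iota l * mon (a + (b + e))%MM).
  apply: cong_trans _ (@mon_term _ _ _); rewrite mdegD.
  by apply: cong_mull; [exact: low_mon | exact: mon_term].
have rE : cong (mdeg (a + b + e)) (mon a * mon b * (iota s * mon e))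
    (iota r * mon (a + b + e)%MM).
  apply: cong_trans _ (@term_term _ _ _ _); rewrite mdegD.
  apply: cong_mulr; first exact: low_term.
  by have := @mon_term a b 1; rewrite rmorph1 mul1r sigma_pow1 mul1r.
rewrite -addmA -mulrA in rE.
have := cong_coords (cong_trans (cong_sym lE) rE) (leqnn _).
by rewrite !coords_term eqxx.
Qed.

Lemma cmon0 a : cmon a 0%MM = 1.
Proof.
have := cong_coords (@mon_term a 0%MM 1).
rewrite rmorph1 mul1r sigma_pow1 mul1r mon0 mulr1 addm0 => /(_ a (leqnn _)).
by rewrite -[mon a]mul1r -(rmorph1 iota) mulrA -rmorphM !coords_term eqxx mulr1.
Qed.

(** The case e = 0 of the cocycle identity: c_(a,b) intertwines sigma^a
    sigma^b and sigma^(a+b). *)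
Lemma cmon_sigma a b s :
  sigma_pow a (sigma_pow b s) * cmon a b = cmon a b * sigma_pow (a + b)%MM s.
Proof. by have := cmon_cocycle a b 0%MM s; rewrite !cmon0 !mulr1 addm0. Qed.

(** The case s = 1 of the cocycle identity. *)
Lemma cmon_assoc a b e :
  sigma_pow a (cmon b e) * cmon a (b + e)%MM = cmon a b * cmon (a + b)%MM e.
Proof. by have := cmon_cocycle a b e 1; rewrite !sigma_pow1 mul1r mulr1. Qed.

(** * Monomials and leading terms of vectors *)

Variables (m : nat) (ge : rel (vmon n m)).
Hypothesis hge : monomial_order ge.

Implicit Types (X Y Z : vmon n m) (u v w : 'cV[A]_m) (G : {fset 'cV[A]_m}).

Local Notation lm := (lm iota x ge).
Local Notation lc := (lc iota x ge).
Local Notation lexp := (lexp iota x ge).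
Local Notation vsupp := (vsupp iota x).

Definition lt Y X : Prop := ge X Y && (X != Y).

Definition vshift X a : vmon n m := ((X.1 + a)%MM, X.2).

Lemma ge_total : total ge. Proof. by have [[]] := hge. Qed.
Lemma ge_anti : antisymmetric ge. Proof. by have [[]] := hge. Qed.
Lemma ge_trans : transitive ge. Proof. by have [[]] := hge. Qed.

Lemma ge_refl X : ge X X.
Proof. by have := ge_total X X; rewrite orbb. Qed.

Lemma lt_nge Y X : lt Y X <-> ~~ ge Y X.
Proof.
split=> [/andP[geXY] | ngeYX].
  by apply: contraNN => geYX; apply/eqP/ge_anti; rewrite geXY.
have := ge_total X Y; rewrite (negPf ngeYX) orbF => geXY; apply/andP; split=> //.
by apply: contraNN ngeYX => /eqP->; exact: ge_refl.
Qed.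

Lemma lt_irr X : ~ lt X X.
Proof. by rewrite /lt eqxx andbF. Qed.

Lemma ge_lt_trans Y X Z : ge X Y -> lt Z Y -> lt Z X.
Proof.
move=> geXY /lt_nge n_ZY; apply/lt_nge; apply: contraNN n_ZY => /ge_trans; exact.
Qed.

Lemma lt_ge_trans Y X Z : lt Y X -> ge Y Z -> lt Z X.
Proof. by move=> /lt_nge n_YX geYZ; apply/lt_nge; apply: contraNN n_YX; exact: ge_trans. Qed.

Lemma lt_ge Y X : lt Y X -> ge X Y.
Proof. by case/andP. Qed.

Lemma lt_trans Y X Z : lt Y X -> lt Z Y -> lt Z X.
Proof. by move/lt_ge; exact: ge_lt_trans. Qed.

Lemma lt_deg Y X : (mdeg Y.1 < mdeg X.1)%N -> lt Y X.
Proof. by have [_ _ _ h] := hge; exact: h. Qed.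

Lemma ge_deg X Y : ge X Y -> (mdeg Y.1 <= mdeg X.1)%N.
Proof. by move=> geXY; rewrite leqNgt; apply/negP => /lt_deg /lt_nge /negP. Qed.

Lemma ge_shift X Y a : ge X Y -> ge (vshift X a) (vshift Y a).
Proof.
case: X Y => [b i] [d j] geXY; rewrite /vshift /= ![(_ + a)%MM]addmC.
by have [_ _ h _] := hge; exact: h.
Qed.

Lemma lt_shift X Y a : lt Y X -> lt (vshift Y a) (vshift X a).
Proof.
case/andP=> /(ge_shift a) geXY neqXY; apply/andP; split=> //.
apply: contraNN neqXY; rewrite !xpair_eqE eqm_add2r /= -xpair_eqE.
by case: X Y {geXY} => [? ?] [].
Qed.

Lemma vshiftD X a b : vshift (vshift X a) b = vshift X (a + b)%MM.
Proof. by rewrite /vshift /= addmA. Qed.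

Lemma vshift0 X : vshift X 0%MM = X.
Proof. by case: X => a i; rewrite /vshift /= addm0. Qed.

Definition vcoef v X : R := coords (v X.2 0) X.1.

Definition vsupported (P : vmon n m -> Prop) v : Prop :=
  forall X, vcoef v X != 0 -> P X.

Lemma vcoefD v w X : vcoef (v + w) X = vcoef v X + vcoef w X.
Proof. by rewrite /vcoef mxE coordsD. Qed.

Lemma vcoef0 X : vcoef 0 X = 0.
Proof. by rewrite /vcoef mxE coords0. Qed.

Lemma vcoefN v X : vcoef (- v) X = - vcoef v X.
Proof. by rewrite /vcoef mxE coordsN. Qed.

Lemma vcoef_sum (I : Type) (s : seq I) (F : I -> 'cV[A]_m) X :
  vcoef (\sum_(i <- s) F i) X = \sum_(i <- s) vcoef (F i) X.
Proof. by rewrite /vcoef summxE coords_sum. Qed.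

Lemma vcoef_inj v w : (forall X, vcoef v X = vcoef w X) -> v = w.
Proof.
move=> vw; apply/matrixP => i j; rewrite [j]ord1; apply: coords_inj => a.
exact: (vw (a, i)).
Qed.

Lemma vsupportedD P v w : vsupported P v -> vsupported P w -> vsupported P (v + w).
Proof.
move=> Pv Pw X; rewrite vcoefD; case: (eqVneq (vcoef v X) 0) => [->|/Pv //].
by rewrite add0r => /Pw.
Qed.

Lemma vsupportedB P v w : vsupported P v -> vsupported P w -> vsupported P (v - w).
Proof.
by move=> Pv Pw; apply: vsupportedD => // X; rewrite vcoefN oppr_eq0 => /Pw.
Qed.

Lemma vsupported0 P : vsupported P 0.
Proof. by move=> X; rewrite vcoef0 eqxx. Qed.

Lemma vsupported_weaken (P Q : vmon n m -> Prop) v :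
  (forall X, P X -> Q X) -> vsupported P v -> vsupported Q v.
Proof. by move=> PQ Pv X /Pv /PQ. Qed.

Lemma mem_vsupp v X : (X \in vsupp v) = (vcoef v X != 0).
Proof.
apply/allpairsPdep/idP => [[i [a [_ a_v ->]]]|]; first by rewrite -mem_finsupp.
by case: X => a i; rewrite -mem_finsupp => a_v; exists i, a; rewrite mem_enum.
Qed.

Lemma lm_head v : lm v = ohead (sort ge (vsupp v)). Proof. by []. Qed.

Lemma lm_spec v X :
  lm v = Some X <-> vcoef v X != 0 /\ vsupported (ge X) v.
Proof.
have memE Y : (Y \in sort ge (vsupp v)) = (vcoef v Y != 0).
  by rewrite mem_sort mem_vsupp.
have lmP Y : lm v = Some Y -> vcoef v Y != 0 /\ vsupported (ge Y) v.
  rewrite lm_head; have := sort_sorted ge_total (vsupp v).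
  case: (sort _ _) memE => //= Z s memE path_Zs [<-].
  split=> [|Y']; rewrite -memE inE ?eqxx // => /predU1P[->|]; first exact: ge_refl.
  exact: (allP (order_path_min ge_trans path_Zs)).
split=> [/lmP //|[vX geX]].
case lmE: (lm v) => [Y|].
  have [vY geY] := lmP _ lmE; congr Some; apply: ge_anti.
  by rewrite geX // geY.
by move: lmE; rewrite lm_head; case: (sort _ _) memE => //= /(_ X); rewrite vX.
Qed.

Lemma lm_none v : lm v = None <-> v = 0.
Proof.
split=> [lmE|->]; last first.
  by case lmE: (lm 0) => [X|] //; have [] := proj1 (lm_spec _ _) lmE; rewrite vcoef0 eqxx.
apply: vcoef_inj => X; rewrite vcoef0; apply/eqP; apply: contraTT isT.
rewrite -mem_vsupp -(mem_sort ge); move: lmE; rewrite lm_head.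
by case: (sort _ _).
Qed.

Lemma lm_exists v : v <> 0 -> exists X, lm v = Some X.
Proof. by case lmE: (lm v) => [X|] v0; [exists X | case: v0; apply/lm_none]. Qed.

Lemma lcE v X : lm v = Some X -> lc v = vcoef v X.
Proof. by rewrite /Defs.lc => ->. Qed.

Lemma lexpE v X : lm v = Some X -> lexp v = X.1.
Proof. by rewrite /Defs.lexp => ->. Qed.

(** * Right multiplication by terms *)

Lemma rmulE v f (i : 'I_m) : (v *m f%:M) i 0 = v i 0 * f.
Proof. by rewrite mxE big_ord1 mxE eqxx mulr1n. Qed.

Lemma rmulDr v f g : v *m (f + g)%:M = v *m f%:M + v *m g%:M.
Proof. by rewrite raddfD mulmxDr. Qed.

Lemma rmulM v f g : v *m (f * g)%:M = v *m f%:M *m g%:M.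
Proof. by rewrite scalar_mxM mulmxA. Qed.

Lemma rmul0 v : v *m (0 : A)%:M = 0.
Proof. by rewrite raddf0 mulmx0. Qed.

Lemma rmulNr v f : v *m (- f)%:M = - (v *m f%:M).
Proof. by rewrite raddfN mulmxN. Qed.

Lemma rmul_sum v (I : Type) (s : seq I) (F : I -> A) :
  v *m (\sum_(i <- s) F i)%:M = \sum_(i <- s) v *m (F i)%:M.
Proof. by rewrite raddf_sum mulmx_sumr. Qed.

(** In the product of r' x^b by r x^a only x^(b+a) and monomials of smaller
    degree occur. *)
Lemma supported_mul_term (P Q : 'X_{1..n} -> Prop) f r a :
  (forall b, P b -> Q (b + a)%MM) ->
  (forall b d, P b -> (mdeg d < mdeg (b + a))%N -> Q d) ->
  supported P f -> supported Q (f * (iota r * mon a)).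
Proof.
move=> PQ lowPQ Pf.
apply: (@supported_ind _ (fun f => supported Q (f * (iota r * mon a))) _ _ _ _ Pf).
- by rewrite mul0r; exact: supported0.
- by move=> g h Qg Qh; rewrite mulrDl; exact: supportedD.
move=> s b Pb; rewrite -[X in supported _ X]
  (subrK (iota (s * sigma_pow b r * cmon b a) * mon (b + a)%MM)).
apply: supportedD; last by apply: supported_term; exact: PQ.
by apply: supported_weaken (@term_term b a r s) => d; exact: lowPQ.
Qed.

Lemma vsupported_term v r a Y : lm v = Some Y ->
  vsupported (ge (vshift Y a)) (v *m (iota r * mon a)%:M).
Proof.
move=> /lm_spec [_ geY] [b i]; rewrite /vcoef rmulE /=; move: b.
apply: (@supported_mul_term (fun b => ge Y (b, i)) (fun b => ge (vshift Y a) (b, i))).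
- by move=> b; exact: (ge_shift a).
- move=> b d /(ge_shift a) geYb lt_db; apply: lt_ge; apply: ge_lt_trans geYb _.
  exact: lt_deg.
- by move=> b; exact: (geY (b, i)).
Qed.

(** Only the leading monomial x^b e_i of [v] can reach x^(b+a) e_i: any other
    monomial x^b' of the same entry gives x^(b'+a) and monomials of degree
    less than |b'+a|, which is at most |b+a|. *)
Lemma vcoef_term v r a Y : lm v = Some Y ->
  vcoef (v *m (iota r * mon a)%:M) (vshift Y a)
  = lc v * sigma_pow Y.1 r * cmon Y.1 a.
Proof.
move=> lmY; rewrite (lcE lmY); move: lmY => /lm_spec [_ geY].
rewrite /vcoef rmulE /=; set f := v _ _; set s := coords f Y.1.
rewrite -[f](subrK (iota s * mon Y.1)) mulrDl coordsD.
rewrite (cong_coords (@term_term _ _ _ _)) // coords_term eqxx.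
have rest_supp : supported (fun b => b <> (Y.1 + a)%MM)
    ((f - iota s * mon Y.1) * (iota r * mon a)).
  apply: (@supported_mul_term (fun b => b != Y.1 /\ ge Y (b, Y.2))).
  - by move=> b [neq_bY _] /eqP; rewrite eqm_add2r (negPf neq_bY).
  - move=> b d [_ /(ge_shift a) /ge_deg /= le_bY] lt_db eq_d.
    by rewrite eq_d ltnNge le_bY in lt_db.
  - move=> b; rewrite coordsD coordsN coords_term.
    case: (eqVneq b Y.1) => [->|neq_bY]; first by rewrite subrr eqxx.
    by rewrite subr0 => fb; split=> //; exact: (geY (b, Y.2)).
rewrite [X in X + _](_ : _ = 0) ?add0r //; apply/eqP.
by apply: contraT => /rest_supp.
Qed.

(** The order refines the degree, so the monomials below a given one belong
    to the finite set of monomials of bounded degree; passing to one of them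
    leaves strictly fewer monomials below. *)
Lemma lt_wf : well_founded lt.
Proof.
move=> X; have [d] := ubnP (mdeg X.1).
pose smaller X :=
  [set Z : 'X_{1..n < d} * 'I_m | ge X (val Z.1, Z.2) && (X != (val Z.1, Z.2))].
have [k] := ubnP #|smaller X|; elim: k X => [X|k IHk X le_Xk lt_Xd]; first by rewrite ltn0.
constructor=> Y lt_YX; have lt_Yd := leq_ltn_trans (ge_deg (lt_ge lt_YX)) lt_Xd.
apply: (IHk Y _ lt_Yd); rewrite ltnS in le_Xk; apply: leq_trans le_Xk; apply: proper_card.
apply/properP; split.
  by apply/subsetP => Z; rewrite !inE => lt_ZY; exact: (lt_trans lt_YX lt_ZY).
exists (BMultinom lt_Yd, Y.2); rewrite !inE /= -surjective_pairing; first exact: lt_YX.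
by rewrite eqxx andbF.
Qed.

(** * Representations by a finite set *)

(** [rep G P v]: [v] is a sum of right multiples of elements of [G] by terms,
    such that the leading monomial of each summand, computed formally,
    satisfies [P]. Cancellation between the summands is allowed; with a bound
    on the monomials, this is a standard representation of [v]. *)
Inductive rep G (P : vmon n m -> Prop) : 'cV[A]_m -> Prop :=
| rep0 : rep G P 0
| rep_cons (g : 'cV[A]_m) Y r a v : g \in G -> lm g = Some Y -> P (vshift Y a) ->
    rep G P v -> rep G P (g *m (iota r * mon a)%:M + v).

Lemma repD G P v w : rep G P v -> rep G P w -> rep G P (v + w).
Proof.
move=> Pv Pw; elim: Pv => [|g Y r a u gG lmg PY _ IHu]; first by rewrite add0r.
by rewrite -addrA; exact: rep_cons gG lmg PY IHu.
Qed.

Lemma rep_term G (P : vmon n m -> Prop) (g : 'cV[A]_m) Y r a :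
  g \in G -> lm g = Some Y -> P (vshift Y a) ->
  rep G P (g *m (iota r * mon a)%:M).
Proof.
move=> gG lmg PY; rewrite -[_ *m _]addr0; apply: rep_cons gG lmg PY _; exact: rep0.
Qed.

Lemma rep_weaken G G' (P Q : vmon n m -> Prop) v :
  {subset G <= G'} -> (forall X, P X -> Q X) -> rep G P v -> rep G' Q v.
Proof.
move=> GG' PQ; elim=> [|g Y r a u gG lmg PY _ IHu]; first exact: rep0.
exact: rep_cons (GG' _ gG) lmg (PQ _ PY) IHu.
Qed.

Lemma rep_sum G P (I : Type) (s : seq I) (Q : pred I) (F : I -> 'cV[A]_m) :
  (forall i : I, Q i -> rep G P (F i)) -> rep G P (\sum_(i <- s | Q i) F i).
Proof.
move=> PF; elim/big_rec: _ => [|i f Qi Pf]; first exact: rep0.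
by apply: repD => //; exact: PF.
Qed.

Lemma rep_mul G (P : vmon n m -> Prop) (S : 'X_{1..n} -> Prop)
    (g : 'cV[A]_m) Y f :
  g \in G -> lm g = Some Y -> (forall a, S a -> P (vshift Y a)) ->
  supported S f -> rep G P (g *m f%:M).
Proof.
move=> gG lmg SP Sf; apply: (@supported_ind S (fun f => rep G P (g *m f%:M))) => //.
- by rewrite rmul0; exact: rep0.
- by move=> f1 f2 r1 r2; rewrite rmulDr; exact: repD.
- by move=> r a /SP; exact: rep_term gG lmg.
Qed.

(** Right multiplication by a term shifts the bound on a representation,
    although each summand g (s x^a) becomes a multiple of [g] by a sum of
    several terms: the new ones have lower degree. *)
Lemma rep_shift G X d r v :
  rep G (fun Z => lt Z X) v ->
  rep G (fun Z => lt Z (vshift X d)) (v *m (iota r * mon d)%:M).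
Proof.
elim=> [|g Y s a u gG lmg lt_YX _ IHu]; first by rewrite mul0mx; exact: rep0.
rewrite mulmxDl -rmulM; apply: repD IHu; apply: (rep_mul gG lmg).
  2: apply: (@supported_mul_term (fun b => b = a)
      (fun b => b = (a + d)%MM \/ (mdeg b < mdeg (a + d))%N)).
- move=> b [->|lt_b]; first by rewrite -vshiftD; exact: lt_shift.
  apply: lt_trans (lt_shift d lt_YX) _; rewrite vshiftD; apply: lt_deg => /=.
  by rewrite !mdegD ltn_add2l -mdegD.
- by move=> b ->; left.
- by move=> b e ->; right.
- exact: supported_term.
Qed.

Lemma vsupported_rep G (P : vmon n m -> Prop) v :
  (forall Y Z, P Y -> ge Y Z -> P Z) -> rep G P v -> vsupported P v.
Proof.
move=> P_down; elim=> [|g Y r a u _ lmg PY _ IHu]; first exact: vsupported0.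
apply: vsupportedD IHu; apply: vsupported_weaken (vsupported_term lmg) => Z.
exact: P_down.
Qed.

(** A non-zero representation has finitely many summands, hence a largest
    formal monomial. *)
Lemma rep_bound G P v : rep G P v -> v = 0 \/ exists X, P X /\ rep G (ge X) v.
Proof.
elim=> [|g Y r a u gG lmg PY _ IHu]; [by left | right].
case: IHu => [->|[X [PX Xu]]].
  exists (vshift Y a); rewrite addr0; split=> //; apply: rep_term gG lmg _.
  exact: ge_refl.
have [geX | geY] := orP (ge_total X (vshift Y a)).
  by exists X; split=> //; exact: rep_cons gG lmg _ Xu.
exists (vshift Y a); split=> //; apply: rep_cons gG lmg _ _; first exact: ge_refl.
by apply: rep_weaken Xu => // Z; exact: ge_trans.
Qed.

Lemma vsupported_lt v X :
  vsupported (ge X) v -> vcoef v X = 0 -> vsupported (fun Z => lt Z X) v.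
Proof.
move=> geX vX0 Z vZ; rewrite /lt geX //=; apply: contraNneq vZ => <-.
by rewrite vX0.
Qed.

(** * Reduction *)

Local Notation reduces1 := (reduces1 iota x ge).
Local Notation reduces := (reduces iota x ge).
Local Notation reduced := (reduced iota x ge).

(** Condition (ii) of the definition says exactly that the leading term
    cancels, and the vector subtracted is a representation all of whose
    summands sit at lm(v). *)
Lemma reduces1_spec G v w : v <> 0 -> reduces1 G v w ->
  exists X, [/\ lm v = Some X, vsupported (fun Z => lt Z X) w & rep G (eq X) (v - w)].
Proof.
move=> v0 [[/v0 //]|[_ [t [g [r [a [gG dvd_g lc_v ->]]]]]]].
have [X lmv] := lm_exists v0; exists X.
have gY (j : 'I_t) : exists Y, lm (g j) = Some Y /\ vshift Y (a j) = X.
  have [Y [Z [lmg lmZ Y2 Y1]]] := dvd_g j; exists Y; split=> //.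
  by move: lmZ; rewrite lmv => -[->]; rewrite /vshift Y1 Y2 -surjective_pairing.
split=> //.
  apply: vsupported_lt; last first.
    rewrite vcoefD vcoefN -(lcE lmv) lc_v vcoef_sum; apply/eqP; rewrite subr_eq0.
    apply/eqP; apply: eq_bigr => j _; have [Y [lmg <-]] := gY j.
    by rewrite (vcoef_term _ _ lmg) (lexpE lmg).
  apply: vsupportedB; first by have [_] := proj1 (lm_spec _ _) lmv.
  elim/big_ind: _ => [|v1 v2|j _]; [exact: vsupported0 | exact: vsupportedD |].
  by have [Y [lmg <-]] := gY j; exact: vsupported_term.
rewrite opprB addrC subrK; apply: rep_sum => j _.
by have [Y [lmg XY]] := gY j; apply: rep_term (gG j) lmg _.
Qed.

Lemma reduces1_0 G w : reduces1 G 0 w -> w = 0.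
Proof. by case=> [[]|[]]. Qed.

Lemma reduces_rep G v w : reduces G v w -> rep G (fun=> True) (v - w).
Proof.
elim=> [u1 u2 red|u|u1 u2 u3 _ IH1 _ IH2]; last 2 first.
- by rewrite subrr; exact: rep0.
- by rewrite -(subrKA u2); exact: repD.
case: (eqVneq u1 0) => [u0|/eqP u0].
  by move: red; rewrite u0 => /reduces1_0 ->; rewrite subrr; exact: rep0.
by have [X [_ _ ]] := reduces1_spec u0 red; exact: rep_weaken.
Qed.

Lemma reduces_lt G X v w : reduces G v w ->
  vsupported (fun Z => lt Z X) v ->
  vsupported (fun Z => lt Z X) w /\ rep G (fun Z => lt Z X) (v - w).
Proof.
elim=> [u1 u2 red|u|u1 u2 u3 _ IH1 _ IH2] lt1; last 2 first.
- by rewrite subrr; split=> //; exact: rep0.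
- have [lt2 rep2] := IH1 lt1; have [lt3 rep3] := IH2 lt2.
  by split=> //; rewrite -(subrKA u2); exact: repD.
case: (eqVneq u1 0) => [u0|/eqP u0].
  move: red; rewrite u0 => /reduces1_0 ->; rewrite subrr; split; last exact: rep0.
  exact: vsupported0.
have [Y [lm1 lt2 rep12]] := reduces1_spec u0 red.
have lt_YX : lt Y X by apply: lt1; have [] := proj1 (lm_spec _ _) lm1.
split; first by apply: vsupported_weaken lt2 => Z; exact: lt_trans.
by apply: rep_weaken rep12 => // Z <-.
Qed.

(** Reduction terminates, because it lowers the leading monomial in a
    well-founded order. *)
Lemma normal_form G v : exists w, reduces G v w /\ reduced G w.
Proof.
have nf0 : exists w, reduces G 0 w /\ reduced G w.
  by exists 0; split; [exact: rt_refl | left].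
case: (eqVneq v 0) => [-> //|/eqP v0]; have [X lmv] := lm_exists v0.
elim: X / (lt_wf X) v v0 lmv => X _ IH v v0 lmv.
case: (classic (exists w, reduces1 G v w)) => [[w vw]|irred]; last first.
  by exists v; split; [exact: rt_refl | right].
have [Y [lmvY ltw _]] := reduces1_spec v0 vw.
have [w' [ww' red']] : exists w', reduces G w w' /\ reduced G w'.
  case: (eqVneq w 0) => [-> //|/eqP w0]; have [Z lmw] := lm_exists w0.
  apply: (IH Z) => //; move: lmvY; rewrite lmv => -[->].
  by apply: ltw; have [] := proj1 (lm_spec _ _) lmw.
by exists w'; split=> //; apply: rt_trans ww'; exact: rt_step.
Qed.

(** * The combinations attached to syzygies *)

Local Notation lcm_lm := (lcm_lm iota x ge).
Local Notation cofactor := (cofactor_exp iota x ge).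
Local Notation syz_row := (syz_row iota x ge).
Local Notation syz_comb := (syz_comb iota x ge).

Definition lm_dvd X v : bool :=
  if lm v is Some Y then (Y.2 == X.2) && (Y.1 <= X.1)%MM else false.

Lemma lm_dvdP X v : lm_dvd X v ->
  exists Y, lm v = Some Y /\ vshift Y (cofactor X v) = X.
Proof.
rewrite /lm_dvd /cofactor_exp /Defs.lexp; case lmv: (lm v) => [Y|] //.
move=> /andP[/eqP Y2 Y1]; exists Y; split=> //.
by rewrite /vshift addmC submK // Y2 -surjective_pairing.
Qed.

Lemma lm_dvd_shift Y X a v : lm v = Some Y -> vshift Y a = X ->
  lm_dvd X v /\ cofactor X v = a.
Proof.
move=> lmv <-; rewrite /lm_dvd /cofactor_exp (lexpE lmv) lmv /= eqxx lem_addr.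
by rewrite addmC addmK.
Qed.

Lemma vlcm_dvd (s : seq (vmon n m)) X : vlcm s = Some X ->
  forall Y, Y \in s -> (Y.2 == X.2) && (Y.1 <= X.1)%MM.
Proof.
rewrite /vlcm; case: s => // Z s; case: ifP => // /allP index_eq [<-] Y Ys.
rewrite index_eq //=; elim: {Z index_eq}(Z :: s) Ys => // Z s' IHs.
rewrite inE big_cons => /predU1P[<-|/IHs]; first exact: lem_mlcml.
by move/lepm_trans; apply; exact: lem_mlcmr.
Qed.

Lemma vlcm_least (s : seq (vmon n m)) X : s != [::] ->
  (forall Y, Y \in s -> (Y.2 == X.2) && (Y.1 <= X.1)%MM) ->
  exists Z a, vlcm s = Some Z /\ vshift Z a = X.
Proof.
case: s => // Y s _ sX; rewrite /vlcm.
have /andP[/eqP Y2 _] := sX Y (mem_head _ _).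
have -> : all (fun Z : vmon n m => Z.2 == Y.2) (Y :: s).
  by apply/allP => Z /sX /andP[/eqP-> _]; rewrite Y2.
set b := \big[_/_]_(_ <- _) _; have bX : (b <= X.1)%MM.
  rewrite /b; elim: (Y :: s) sX => [|Z s' IHs] sX.
    by rewrite big_nil; apply/mnm_lepP => k; rewrite mnm0E.
  rewrite big_cons lem_mlcm IHs ?andbT => [|W Ws]; last by apply: sX; rewrite inE Ws orbT.
  by have /andP[] := sX Z (mem_head _ _).
exists (b, Y.2), (X.1 - b)%MM; split=> //.
by rewrite /vshift /= addmC submK // Y2 -surjective_pairing.
Qed.

Lemma lcm_lm_dvd (S : {fset 'cV[A]_m}) X v :
  lcm_lm S = Some X -> v \in S -> v <> 0 -> lm_dvd X v.
Proof.
move=> lcmS vS /lm_exists [Y lmv]; rewrite /lm_dvd lmv.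
by apply: (vlcm_dvd lcmS); rewrite mem_pmap -lmv map_f.
Qed.

Lemma lcm_lm_least (S : {fset 'cV[A]_m}) X :
  S != fset0 -> (forall v, v \in S -> lm_dvd X v) ->
  exists Z a, lcm_lm S = Some Z /\ vshift Z a = X.
Proof.
move=> /fset0Pn[v vS] SX; apply: vlcm_least => [|Y].
  have [Y [lmv _]] := lm_dvdP (SX _ vS).
  have : Y \in pmap lm (enum_fset S) by rewrite mem_pmap -lmv map_f.
  by case: (pmap _ _).
by rewrite mem_pmap => /mapP[w /SX]; rewrite /lm_dvd => wX lmw; rewrite -lmw in wX.
Qed.

Lemma sigma_powK a : cancel (sigma_pow a) (inv_fun (sigma_pow a)).
Proof. exact: (proj1 (inv_funP (sigma_pow_bij a))). Qed.

Lemma sigma_powVK a : cancel (inv_fun (sigma_pow a)) (sigma_pow a).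
Proof. exact: (proj2 (inv_funP (sigma_pow_bij a))). Qed.

Lemma sigma_pow_sum a (I : Type) (s : seq I) (F : I -> R) :
  sigma_pow a (\sum_(i <- s) F i) = \sum_(i <- s) sigma_pow a (F i).
Proof.
apply: (big_morph (sigma_pow a)); [exact: sigma_powD | exact: sigma_pow_r0].
Qed.

(** In the algorithm a + b is the exponent of X_S, so the inner argument does
    not depend on the generator: this makes right multiplication by a common
    coefficient possible. *)
Lemma inv_psi a b r :
  inv_fun (psi iota x a b) r = sigma_pow b (inv_fun (sigma_pow (a + b)%MM) r).
Proof.
have psi_bij : bijective (psi iota x a b).
  apply: (bij_comp (sigma_pow_bij (a + b)%MM)).
  by exists (sigma_pow b); [exact: sigma_powVK | exact: sigma_powK].
apply: (bij_inj psi_bij); rewrite (proj2 (inv_funP psi_bij)).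
by rewrite /psi sigma_powK sigma_powVK.
Qed.

Lemma syz_combE (S : {fset 'cV[A]_m}) X (b : 'cV[R]_(size (enum_fset S))) :
  (forall v, v \in S -> lm_dvd X v) ->
  syz_comb X b = \sum_(j < size (enum_fset S))
    let v := (enum_fset S)`_j in let a := cofactor X v in
    v *m (iota (sigma_pow a (inv_fun (sigma_pow X.1) (b j 0))) * mon a)%:M.
Proof.
move=> SX; rewrite /Defs.syz_comb; apply: eq_bigr => j _ /=.
have [Y [lmY YX]] := lm_dvdP (SX _ (mem_nth 0 (ltn_ord j))).
by rewrite inv_psi (lexpE lmY) -[(Y.1 + _)%MM]/((vshift Y _).1) YX.
Qed.

(** The twist by sigma^a turns the factor sigma^b(sigma^a(r)) c_(b,a) of the
    coefficient into c_(b,a) sigma^(b+a)(r), so that the unknown coefficient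
    appears on the right, as in a right syzygy. *)
Lemma vcoef_twisted_term v Y r a : lm v = Some Y ->
  vcoef (v *m (iota (sigma_pow a r) * mon a)%:M) (vshift Y a)
  = lc v * cmon Y.1 a * sigma_pow (Y.1 + a)%MM r.
Proof.
by move=> lmv; rewrite (vcoef_term _ _ lmv) -mulrA cmon_sigma mulrA.
Qed.

(** The coefficient at X_S is the entry of the product of the row by the
    syzygy, which is zero. *)
Lemma syz_comb_lt (S : {fset 'cV[A]_m}) X (b : 'cV[R]_(size (enum_fset S))) :
  (forall v, v \in S -> lm_dvd X v) -> rsyz (syz_row S X) b ->
  vsupported (fun Z => lt Z X) (syz_comb X b).
Proof.
move=> SX syz_b; rewrite syz_combE //.
have dvd_nth (j : 'I_(size (enum_fset S))) := lm_dvdP (SX _ (mem_nth 0 (ltn_ord j))).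
apply: vsupported_lt.
  elim/big_ind: _ => [|v1 v2|j _ /=]; [exact: vsupported0 | exact: vsupportedD |].
  have [Y [lmv YX]] := dvd_nth j.
  by rewrite -[X in vsupported (ge X)]YX; exact: vsupported_term.
rewrite vcoef_sum; have /matrixP /(_ 0 0) := syz_b; rewrite !mxE => syz0; rewrite -[RHS]syz0.
apply: eq_bigr => j _; rewrite mxE /=; have [Y [lmv YX]] := dvd_nth j.
have := vcoef_twisted_term (inv_fun (sigma_pow X.1) (b j 0)) (cofactor X (enum_fset S)`_j) lmv.
by rewrite -[(Y.1 + _)%MM]/((vshift Y _).1) YX sigma_powVK (lexpE lmv).
Qed.

(** The key step of the criterion: a cancellation at X x^d, where X is a
    common multiple of the leading monomials of [S] (the least one in the
    algorithm), is a consequence of the generators of the syzygies at X.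
    Writing the coefficients as rho_j = sigma^(a_j)(w_j) c_(a_j,d), the
    cocycle identities give the cancelling sum the form (sum_j lc(v_j)
    c_(b_j,a_j) sigma^X(w_j)) c_(X,d); hence the sigma^X(w_j) are a syzygy,
    and expanding it on [B] expresses the sum, up to smaller terms, by the
    combinations attached to [B] multiplied on the right by terms of exponent
    d. *)
Lemma syz_lift G (S : {fset 'cV[A]_m}) X d (B : seq 'cV[R]_(size (enum_fset S)))
    (rho : 'I_(size (enum_fset S)) -> R) :
  {subset S <= G} -> (forall v, v \in S -> lm_dvd X v) ->
  rsyz_generators (syz_row S X) B ->
  (forall b : 'cV[R]_(size (enum_fset S)), b \in B ->
     rep G (fun Z => lt Z X) (syz_comb X b)) ->
  \sum_(j < size (enum_fset S)) (let v := (enum_fset S)`_j in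
    lc v * sigma_pow (lexp v) (rho j) * cmon (lexp v) (cofactor X v + d)%MM) = 0 ->
  rep G (fun Z => lt Z (vshift X d)) (\sum_(j < size (enum_fset S))
    let v := (enum_fset S)`_j in
    v *m (iota (rho j) * mon (cofactor X v + d)%MM)%:M).
Proof.
move=> SG SX; set k := size (enum_fset S) in B rho *; move=> B_gen B_rep coef0.
pose v (j : 'I_k) := (enum_fset S)`_j; pose a (j : 'I_k) := cofactor X (v j).
have vS (j : 'I_k) : v j \in S by exact: mem_nth.
have [Y YP] : exists Y : 'I_k -> vmon n m, forall j : 'I_k,
    lm (v j) = Some (Y j) /\ vshift (Y j) (a j) = X.
  by apply: (@fun_choice _ _
    (fun (j : 'I_k) Y => lm (v j) = Some Y /\ vshift Y (a j) = X)) => j;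
    exact: lm_dvdP (SX _ (vS j)).
have lmv (j : 'I_k) := proj1 (YP j); have YX (j : 'I_k) := proj2 (YP j).
have YaX (j : 'I_k) : ((Y j).1 + a j)%MM = X.1 by rewrite -[X in _ = X.1](YX j).
pose tau := inv_fun (sigma_pow X.1).
have [w rhoE] : exists w : 'I_k -> R, forall j : 'I_k,
    rho j = sigma_pow (a j) (w j) * cmon (a j) d.
  apply: (@fun_choice _ _ (fun (j : 'I_k) (w : R) =>
    rho j = sigma_pow (a j) w * cmon (a j) d)) => j.
  have [c' [_ c'c]] := cmon_invertible (a j) d.
  exists (inv_fun (sigma_pow (a j)) (rho j * c')).
  by rewrite sigma_powVK -mulrA c'c mulr1.
pose z : 'cV[R]_k := \col_j sigma_pow X.1 (w j).
(* [c_(X,d)] is common to all the summands, and is cancelled by its inverse. *)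
have z_syz : rsyz (syz_row S X) z.
  apply/matrixP => i i'; rewrite !mxE.
  have [c' [cc' _]] := cmon_invertible X.1 d.
  have /(congr1 (fun r => r * c')) := coef0; rewrite mul0r mulr_suml => coef0c.
  rewrite -[RHS]coef0c.
  apply: eq_bigr => j _; rewrite !mxE /= -/(v j) -/(a j) (lexpE (lmv j)) rhoE.
  rewrite sigma_powM -!mulrA; congr (_ * _).
  rewrite (mulrA (sigma_pow _ (cmon _ _))) cmon_assoc YaX -mulrA cc' mulr1.
  by rewrite cmon_sigma YaX.
have [t zE] := proj1 (B_gen z) z_syz.
have wE (j : 'I_k) : w j = \sum_(l < size B) tau (B`_l j 0) * tau (t l).
  apply: (bij_inj (sigma_pow_bij X.1)); rewrite sigma_pow_sum.
  have := congr1 (fun u : 'cV_k => u j 0) zE; rewrite mxE summxE => ->.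
  apply: eq_bigr => l _; rewrite sigma_powM !sigma_powVK.
  by rewrite mxE big_ord1 mxE eqxx mulr1n.
pose h (j : 'I_k) (l : 'I_(size B)) : A :=
  (iota (sigma_pow (a j) (tau (B`_l j 0))) * mon (a j)) * (iota (tau (t l)) * mon d).
have hE (j : 'I_k) : cong (mdeg (a j + d)) (iota (rho j) * mon (a j + d)%MM) (\sum_l h j l).
  rewrite rhoE wE sigma_pow_sum mulr_suml rmorph_sum mulr_suml /cong -sumrB.
  apply: supported_sum => l _; rewrite sigma_powM -/(cong _ _ _).
  exact: cong_sym (@term_term _ _ _ _).
rewrite (eq_bigr (fun j : 'I_k => v j *m (iota (rho j) * mon (a j + d)%MM - \sum_l h j l)%:M
    + \sum_l v j *m (h j l)%:M)); last first.
  by move=> j _; rewrite -rmul_sum -rmulDr subrK.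
rewrite big_split /=; apply: repD.
  apply: rep_sum => j _; apply: (rep_mul (SG _ (vS j)) (lmv j) _ (hE j)) => b lt_b.
  by rewrite -(YX j) vshiftD; apply: lt_deg; rewrite /= !mdegD ltn_add2l -mdegD.
(* Summed over the generators first, the main part is made of multiples of
   the combinations attached to [B]. *)
rewrite exchange_big; apply: rep_sum => l _.
under eq_bigr do rewrite rmulM.
rewrite -mulmx_suml -(syz_combE _ SX); apply: rep_shift; apply: B_rep.
exact: mem_nth.
Qed.

(** * Buchberger's criterion *)

Definition lm_divisors G X : {fset 'cV[A]_m} := [fset v in G | lm_dvd X v]%fset.

(** Collects the summands whose formal leading monomial is X: there is at
    most one per element of [G], as right multiples of [g] by terms of the
    same exponent add up. *)
Lemma rep_split G X v : rep G (ge X) v ->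
  exists rho : 'cV[A]_m -> R, rep G (fun Z => lt Z X)
    (v - \sum_(u <- enum_fset (lm_divisors G X))
           u *m (iota (rho u) * mon (cofactor X u))%:M).
Proof.
elim=> [|g Y r a u gG lmg geX _ [rho rep_u]].
  exists (fun=> 0); rewrite big1 ?subr0 => [|u _]; first exact: rep0.
  by rewrite rmorph0 mul0r rmul0.
case: (eqVneq (vshift Y a) X) => [YX|YX]; last first.
  exists rho; rewrite -addrA; apply: rep_cons gG lmg _ rep_u.
  by rewrite /lt geX eq_sym.
have [gX cof] := lm_dvd_shift lmg YX.
have gS : g \in enum_fset (lm_divisors G X) by rewrite !inE gG.
exists (fun h : 'cV[A]_m => if h == g then rho h + r else rho h).
move: rep_u; rewrite !(bigD1_seq g) ?fset_uniq //= eqxx cof.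
rewrite [X in _ -> rep _ _ (_ - (_ + X))](eq_bigr
  (fun h : 'cV[A]_m => h *m (iota (rho h) * mon (cofactor X h))%:M)); last first.
  by move=> h /negPf ->.
move=> rep_u.
rewrite rmorphD mulrDl rmulDr [X in _ - (X + _)]addrC -[X in _ - X]addrA.
by rewrite opprD addrACA subrr add0r.
Qed.

(** Well-founded induction on a monomial X bounding a representation of [v].
    Either the coefficient at X survives, and gives a reduction, or
    [syz_lift] lowers the bound. *)
Theorem buchberger_criterion G v :
  (forall g : 'cV[A]_m, g \in G -> g <> 0) ->
  (forall (S : {fset 'cV[A]_m}) X, {subset S <= G} -> lcm_lm S = Some X ->
     exists B, rsyz_generators (syz_row S X) B /\
       forall b : 'cV[R]_(size (enum_fset S)), b \in B ->
         rep G (fun Z => lt Z X) (syz_comb X b)) ->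
  rep G (fun=> True) v -> v <> 0 -> exists w, reduces1 G v w.
Proof.
move=> G0 syzG rep_v v0; have [// | [X [_ {}rep_v]]] := rep_bound rep_v.
elim: X / (lt_wf X) rep_v => X _ IH rep_v.
have [rho rep_w] := rep_split rep_v; set S := lm_divisors G X in rep_w.
have SX u : u \in S -> lm_dvd X u by rewrite !inE => /andP[].
have SG : {subset S <= G} by move=> u; rewrite !inE => /andP[].
rewrite (big_nth 0) big_mkord in rep_w; set k := size (enum_fset S) in rep_w.
pose u (j : 'I_k) : 'cV[A]_m := (enum_fset S)`_j.
have uS (j : 'I_k) : u j \in S by exact: mem_nth.
have coef_v : vcoef v X = \sum_(j < k)
    lc (u j) * sigma_pow (lexp (u j)) (rho (u j)) * cmon (lexp (u j)) (cofactor X (u j)).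
  have lt_down Y Z : lt Y X -> ge Y Z -> lt Z X by exact: lt_ge_trans.
  have /(_ X) := vsupported_rep lt_down rep_w.
  case: eqVneq => [|_ /(_ isT) /lt_irr //]; rewrite vcoefD vcoefN vcoef_sum.
  move=> /eqP; rewrite subr_eq0 => /eqP-> _; apply: eq_bigr => j _.
  have [Y [lmY YX]] := lm_dvdP (SX _ (uS j)).
  have := vcoef_term (rho (u j)) (cofactor X (u j)) lmY.
  by rewrite YX (lexpE lmY).
case: (eqVneq (vcoef v X) 0) => [vX0 | vX_neq0]; last first.
  have ge_down Y Z : ge X Y -> ge Y Z -> ge X Z by exact: ge_trans.
  have lmv : lm v = Some X by apply/lm_spec; split=> //; exact: vsupported_rep rep_v.
  eexists; right; split=> //; exists k, u, (rho \o u), (cofactor X \o u).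
  split=> [j|j||]; last reflexivity.
  - exact: SG (uS j).
  - have [Y [lmY YX]] := lm_dvdP (SX _ (uS j)).
    by exists Y, X; split=> //; [exact: (congr1 snd YX) | exact: (congr1 fst YX)].
  - by rewrite (lcE lmv) coef_v.
have {}rep_v : rep G (fun Z => lt Z X) v.
  rewrite -[v](subrK (\sum_(j < k) u j *m (iota (rho (u j)) * mon (cofactor X (u j)))%:M)).
  apply: repD rep_w _; case: (eqVneq S fset0) => [S0|S_neq0].
    by apply: rep_sum => j _; have := uS j; rewrite S0 inE.
  have [Z [d [lcmS ZX]]] := lcm_lm_least S_neq0 SX.
  have SZ w : w \in S -> lm_dvd Z w.
    by move=> wS; apply: lcm_lm_dvd lcmS _ (G0 _ _); rewrite ?SG.
  have cofE (j : 'I_k) : cofactor X (u j) = (cofactor Z (u j) + d)%MM.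
    have [Y [lmY YZ]] := lm_dvdP (SZ _ (uS j)).
    by apply: (proj2 (lm_dvd_shift lmY _)); rewrite -vshiftD YZ.
  have [B [B_gen B_rep]] := syzG _ _ SG lcmS.
  rewrite -ZX; have := @syz_lift G S Z d B (rho \o u) SG SZ B_gen B_rep.
  rewrite /= -/k => lift; under eq_bigr do rewrite ZX cofE.
  apply: lift; rewrite -[RHS]vX0 coef_v; apply: eq_bigr => j _.
  by rewrite -/(u j) -cofE.
have [// | [Y [lt_YX rep_Y]]] := rep_bound rep_v.
exact: IH lt_YX rep_Y.
Qed.

(** * Termination *)

Local Notation state := (@state A m).
Local Notation step := (step iota x ge).

Definition extends G' G : Prop :=
  exists r : 'cV[A]_m, [/\ r <> 0, reduced G r & G' = (r |` G)%fset].

(** As the maps sigma^b are onto and the constants c_(b,a) are units, the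
    elements lc(g) sigma^b(r) c_(b,a) are all those of the right ideal
    lc(g)R: reducibility is membership of lc(v) in a right ideal. *)
Lemma reducible_of_lc G v X (t : nat) (g : 'I_t -> 'cV[A]_m)
    (Y : 'I_t -> vmon n m) (s : 'I_t -> R) :
  v <> 0 -> lm v = Some X ->
  (forall j : 'I_t, [/\ g j \in G, lm (g j) = Some (Y j), (Y j).2 = X.2
     & ((Y j).1 <= X.1)%MM]) ->
  lc v = \sum_(j < t) lc (g j) * s j -> exists w, reduces1 G v w.
Proof.
move=> v0 lmv gP lcv; pose a (j : 'I_t) : 'X_{1..n} := (X.1 - (Y j).1)%MM.
have [r rE] : exists r : 'I_t -> R, forall j : 'I_t,
    sigma_pow (Y j).1 (r j) * cmon (Y j).1 (a j) = s j.
  apply: (@fun_choice _ _ (fun (j : 'I_t) r =>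
    sigma_pow (Y j).1 r * cmon (Y j).1 (a j) = s j)) => j.
  have [c' [_ c'c]] := cmon_invertible (Y j).1 (a j).
  by exists (inv_fun (sigma_pow (Y j).1) (s j * c')); rewrite sigma_powVK -mulrA c'c mulr1.
eexists; right; split=> //; exists t, g, r, a; split=> [j|j||]; last reflexivity.
- by have [] := gP j.
- have [_ lmg Y2 Y1] := gP j; exists (Y j), X; split=> //.
  by rewrite /a addmC submK.
- rewrite lcv; apply: eq_bigr => j _; have [_ lmg _ _] := gP j.
  by rewrite (lexpE lmg) -mulrA rE.
Qed.

Lemma extends_wf : right_noetherian R -> well_founded extends.
Proof.
move=> noethR G0; apply: acc_of_no_descent => -[G [_ extG]].
have [r rP] := fun_choice extG.
have r_mem : forall k l : nat, (l < k)%N -> r l \in G k.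
  elim=> // k IHk l; rewrite ltnS leq_eqVlt => lk; have [_ _ ->] := rP k.
  by rewrite !inE; case/predU1P: lk => [->|/IHk ->]; rewrite ?eqxx ?orbT.
have [X lmX] : exists X : nat -> vmon n m, forall k : nat, lm (r k) = Some (X k).
  apply: (@fun_choice _ _ (fun (k : nat) X => lm (r k) = Some X)) => k.
  by apply: lm_exists; have [] := rP k.
have [phi [phi_lt phi_dvd]] := dickson X.
have [N [s lcN]] := noetherian_sequence (fun k : nat => lc (r (phi k))) noethR.
have [rN0 [//|irred] _] := rP (phi N); apply: irred.
apply: (@reducible_of_lc _ _ (X (phi N)) N (fun j : 'I_N => r (phi j))
  (fun j : 'I_N => X (phi j)) s) => // j.
by have [dvd1 dvd2] := phi_dvd _ _ (ltnW (ltn_ord j)); split=> //; apply/r_mem/phi_lt.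
Qed.

(** Induction on [G'] for [extends]; while [G'] is unchanged, the work lists
    get shorter, and a pass that leaves [G'] unchanged ends at the exit. *)
Lemma step_acc : right_noetherian R -> forall s : state,
  Acc (fun s' s : state => step s s') s.
Proof.
move=> noethR; pose accs (s : state) := Acc (fun s' s : state => step s s') s.
have accO G : accs (Output G) by constructor=> s' st; inversion st.
suff accG G' : forall G, [/\ accs (While G G'), forall D, accs (ForSubsets G G' D)
    & forall D ps, accs (ForSyzygies G G' D ps)].
  case=> [G G'|G G' D|G G' D ps|G]; last exact: accO.
  - by have [accW _ _] := accG G' G; exact: accW.
  - by have [_ accD _] := accG G' G; exact: accD.
  - by have [_ _ accps] := accG G' G; exact: accps.
elim: G' / (extends_wf noethR G') => G' _ IH.
have accSyz G D : accs (ForSubsets G G' D) ->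
    forall ps, accs (ForSyzygies G G' D ps).
  move=> accD; elim=> [|p ps IHps]; constructor=> s' st; inversion st; subst.
    exact: accD.
  case: (eqVneq r 0) => [_|/eqP r0]; first exact: IHps.
  have ext_r : extends (r |` G')%fset G' by exists r.
  by have [_ _ accps] := IH _ ext_r G; exact: accps.
have accSub G : accs (While G G') -> forall D, accs (ForSubsets G G' D).
  move=> accW; elim=> [|S D IHD]; constructor=> s' st; inversion st; subst.
  - exact: accW.
  - exact: IHD.
  - exact: accSyz IHD _.
have accW G : accs (While G G').
  constructor=> s' st; inversion st; subst; first exact: accO.
  apply: accSub; constructor=> s'' st'; inversion st'; subst; first exact: accO.
  congruence.
move=> G; split=> [|D|D ps]; first exact: accW.
  exact: accSub (accW G) _.
exact: accSyz (accSub _ (accW G) _) _.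
Qed.

(** * Progress *)

Lemma step_progress (hR : RGS R) (s : state) :
  (exists G, s = Output G) \/ (exists s' : state, step s s').
Proof.
case: s => [G G'|G G' [|S D]|G G' D [|p ps]|G].
- right; case: (eqVneq G' G) => [->|/eqP neqG]; first by eexists; exact: StepExit.
  by eexists; apply: StepEnter neqG (perm_refl _).
- by right; eexists; exact: StepLoop.
- right; case lcmS: (lcm_lm S) => [X|]; last by eexists; exact: StepSkip.
  by eexists; apply: StepSubset lcmS (RGS_syzP hR _).
- by right; eexists; exact: StepNextSubset.
- by right; have [r [red_r nf_r]] := normal_form G' p; eexists; exact: StepReduce red_r nf_r.
- by left; exists G.
Qed.

(** * The invariant of the algorithm *)

Section Correctness.
Variable F : {fset 'cV[A]_m}.
Hypothesis hF0 : forall v : 'cV[A]_m, v \in F -> v <> 0.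

Local Notation span := (rspan (enum_fset F)).

Definition basis_candidate G : Prop :=
  {subset F <= G} /\ forall v, v \in G -> v <> 0 /\ span v.

(** The combinations of some generating set of syzygies of [S] either wait in
    [ps] or have a representation below X_S. A representation is asked for,
    rather than a reduction to 0: a combination whose remainder is not 0 gets
    one as soon as this remainder is added to [G]. *)
Definition handled G (ps : seq 'cV[A]_m) (S : {fset 'cV[A]_m}) : Prop :=
  forall X, lcm_lm S = Some X ->
  exists B, rsyz_generators (syz_row S X) B /\
    forall b : 'cV[R]_(size (enum_fset S)), b \in B ->
      syz_comb X b \in ps \/ rep G (fun Z => lt Z X) (syz_comb X b).

(** While a pass is running, a subset of [G] is handled unless it waits in
    the list [D]; outside a pass every subset of [G] is. *)
Definition invariant (s : state) : Prop :=
  match s with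
  | While G G' => [/\ basis_candidate G', {subset G <= G'}
      & forall S : {fset 'cV[A]_m}, {subset S <= G} -> handled G' [::] S]
  | ForSubsets G G' D => [/\ basis_candidate G', {subset G <= G'},
      forall S : {fset 'cV[A]_m}, S \in D -> {subset S <= G}
      & forall S : {fset 'cV[A]_m}, {subset S <= G} -> S \in D \/ handled G' [::] S]
  | ForSyzygies G G' D ps => [/\ basis_candidate G', {subset G <= G'},
      forall S : {fset 'cV[A]_m}, S \in D -> {subset S <= G},
      forall S : {fset 'cV[A]_m}, {subset S <= G} -> S \in D \/ handled G' ps S
      & forall v, v \in ps -> span v]
  | Output G => basis_candidate G /\
      forall S : {fset 'cV[A]_m}, {subset S <= G} -> handled G [::] S
  end.

Lemma rep_span G P v : basis_candidate G -> rep G P v -> span v.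
Proof.
move=> [_ G_span]; elim=> [|g Y r a u gG _ _ _ IHu]; first exact: rspan0.
by apply: rspanD IHu; apply: rspanM; have [] := G_span _ gG.
Qed.

Lemma span_rep G v : basis_candidate G -> span v -> rep G (fun=> True) v.
Proof.
move=> [FG _] [c ->]; apply: rep_sum => j _.
have jF : (enum_fset F)`_j \in F by exact: mem_nth.
have [Y lmj] := lm_exists (hF0 jF).
exact: (@rep_mul _ _ (fun=> True) _ _ _ (FG _ jF) lmj).
Qed.

Lemma reduces_span G (p r : 'cV[A]_m) : basis_candidate G -> reduces G p r -> span p -> span r.
Proof.
move=> G_ok /reduces_rep /(rep_span G_ok) span_pr span_p.
have -> : r = p + (p - r) *m (- 1)%:M by rewrite rmulNr mulmx1 opprB addrC subrK.
by apply: rspanD => //; exact: rspanM.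
Qed.

Lemma handled_weaken G G' ps ps' S :
  {subset G <= G'} -> {subset ps <= ps'} -> handled G ps S -> handled G' ps' S.
Proof.
move=> GG' pps hS X lcmS; have [B [B_gen B_ok]] := hS X lcmS.
exists B; split=> // b /B_ok [/pps|rep_b]; [by left | right].
exact: rep_weaken rep_b.
Qed.

(** The combination [p] is below X_S by the syzygy relation, so all the steps
    of its reduction to [r] use summands below X_S, and [r] itself, once
    added to [G], represents what remains. *)
Lemma handled_reduce G (p : 'cV[A]_m) ps (r : 'cV[A]_m) S :
  (forall v, v \in S -> v <> 0) -> reduces G p r ->
  handled G (p :: ps) S -> handled (if r == 0 then G else r |` G)%fset ps S.
Proof.
move=> S0 red_pr hS X lcmS; have [B [B_gen B_ok]] := hS X lcmS.
set G' := (if _ then _ else _); have GG' : {subset G <= G'}.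
  by move=> v vG; rewrite /G'; case: ifP => // _; rewrite !inE vG orbT.
exists B; split=> // b bB; have [|rep_b] := B_ok b bB; last first.
  by right; exact: rep_weaken rep_b.
rewrite inE => /predU1P[pE|]; [right | by left].
have SX v : v \in S -> lm_dvd X v by move=> vS; exact: lcm_lm_dvd lcmS vS (S0 _ vS).
have p_lt : vsupported (fun Z => lt Z X) p.
  by rewrite -pE; apply: syz_comb_lt SX _; apply/B_gen; exact: rspan_mem.
have [r_lt rep_pr] := reduces_lt red_pr p_lt.
rewrite pE -(subrK r p); apply: repD; first exact: rep_weaken rep_pr.
case: (eqVneq r 0) => [->|r0]; first exact: rep0.
have [Z lmr] : exists Z, lm r = Some Z by apply: lm_exists; apply/eqP.
have rE : r = r *m (iota 1 * mon 0%MM)%:M by rewrite rmorph1 mon0 mulr1 mulmx1.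
have rG' : r \in G' by rewrite /G' (negPf r0) !inE eqxx.
rewrite rE; apply: (rep_term _ rG' lmr).
by rewrite vshift0; apply: r_lt; have [] := proj1 (lm_spec _ _) lmr.
Qed.

Lemma basis_candidate_reduce G (p r : 'cV[A]_m) : basis_candidate G -> span p ->
  reduces G p r -> basis_candidate (if r == 0 then G else r |` G)%fset.
Proof.
move=> G_ok span_p red_pr; have [FG G_span] := G_ok.
case: (eqVneq r 0) => // /eqP r0; split=> v; rewrite !inE; first by move/FG->; rewrite orbT.
by move=> /predU1P[->|/G_span //]; split=> //; exact: reduces_span red_pr span_p.
Qed.

(** On entry in the loop a subset of [G'] either is in [D] or was already a
    subset of the old [G], hence handled: this is why it is enough to treat
    the new subsets. *)
Lemma invariant_step (s s' : state) : step s s' -> invariant s -> invariant s'.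
Proof.
case=> {s s'}.
- by move=> G [G_ok _ hG].
- move=> G G' D neqG permD [G'_ok GG' hG].
  have memD S : (S \in D) = (S `<=` G')%fset && ~~ (S `<=` G)%fset.
    by rewrite (perm_mem permD) !inE !fpowersetE andbC.
  split=> // [S|S SG']; rewrite memD; first by case/andP=> /fsubsetP.
  case: (boolP (S `<=` G)%fset) => [/fsubsetP /hG|_]; [by right | left].
  by rewrite andbT; apply/fsubsetP.
- move=> G G' S D lcmS [G'_ok GG' DG hG]; split=> // [T TD|T /hG].
    by apply: DG; rewrite inE TD orbT.
  rewrite inE => -[/predU1P[->|]|]; [right | by left | by right].
  by move=> X; rewrite lcmS.
- move=> G G' S D X B lcmS B_gen [G'_ok GG' DG hG].
  have SG : {subset S <= G} by apply: DG; exact: mem_head.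
  split=> // [T TD|T /hG|p /mapP[b bB ->]].
  + by apply: DG; rewrite inE TD orbT.
  + rewrite inE => -[/predU1P[->|]|hT]; [right | by left | right].
      move=> Y; rewrite lcmS => -[<-]; exists B; split=> // b bB; left.
      exact: map_f.
    exact: handled_weaken hT.
  + rewrite /Defs.syz_comb; elim/big_ind: _ => [|v w|j _]; [exact: rspan0 | exact: rspanD |].
    by apply: rspanM; have [_ /(_ _ (GG' _ (SG _ (mem_nth 0 (ltn_ord j)))))[]] := G'_ok.
- move=> G G' D p ps r red_pr _ [G'_ok GG' DG hG ps_span].
  have span_p : span p by apply: ps_span; exact: mem_head.
  split=> //; first exact: basis_candidate_reduce red_pr.
  + by move=> v /GG' vG'; case: ifP => // _; rewrite !inE vG' orbT.
  + move=> S SG; have [|hS] := hG S SG; [by left | right].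
    apply: handled_reduce red_pr hS => v /SG /GG' vG'.
    by have [_ /(_ _ vG')[]] := G'_ok.
  + by move=> q qps; apply: ps_span; rewrite inE qps orbT.
- by move=> G G' D [].
- by move=> G G' [G'_ok GG' _ hG]; split=> // S /hG [].
Qed.

Lemma invariant_initial : invariant (initial F).
Proof.
split=> // [|S S0 X].
  by split=> // v vF; split; [exact: hF0 | exact: rspan_mem].
rewrite /Defs.lcm_lm (_ : S = fset0) //; apply/fsetP => v; rewrite inE.
by apply/negP => /S0; rewrite inE.
Qed.

Lemma invariant_reachable (s : state) : reachable iota x ge F s -> invariant s.
Proof.
move=> reach; elim: (clos_rt_rtn1 _ _ _ _ reach) => [|s1 s2 st _ IH].
  exact: invariant_initial.
exact: invariant_step st IH.
Qed.

Lemma output_grobner G : F <> fset0 -> invariant (Output G) ->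
  grobner_basis iota x ge span G.
Proof.
move=> F_neq0 [G_ok hG]; have [FG G_span] := G_ok; split=> // [G0|v v0 span_v].
  by apply: F_neq0; apply/fsetP => v; rewrite inE; apply/negP => /FG; rewrite G0 inE.
case=> [//|]; apply; apply: (buchberger_criterion (G := G)) v0; last exact: span_rep.
  by move=> g /G_span[].
move=> S X /hG hS /hS [B [B_gen B_ok]]; exists B; split=> // b /B_ok[].
  by rewrite in_nil.
by [].
Qed.

End Correctness.

End PBW.

Theorem corollary5p5 (R A : pzRingType) (iota : {rmorphism R -> A})
    (n : nat) (x : 'I_n -> A)
    (hA : skew_PBW iota x) (hbij : bijective_PBW iota x) (hR : RGS R)
    (m : nat) (hm : (1 <= m)%N)
    (ge : rel (vmon n m)) (hge : monomial_order ge)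
    (F : {fset 'cV[A]_m}) (hF : F <> fset0)
    (hF0 : forall f, f \in F -> f <> 0%R) :
  buchberger_produces iota x ge F
    (grobner_basis iota x ge (rspan (enum_fset F))).
Proof.
split=> [|s _|G reachG].
- exact: (no_descent_of_acc (step_acc hA hbij hge (RGS_noetherian hR) (initial F))).
- exact: step_progress.
- by apply: output_grobner => //; exact: invariant_reachable.
Qed.
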